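(* Let $f:\mathcal{D}\to\mathbb{R}$ be a $\tau(f)$-strongly convex quadratic function on the open set $\mathcal{D}\subseteq\mathbb{R}^n$, satisfying the holomorphic extension assumption for some $\bar\delta\in(0,1)$, with minimizer $x^\star\in\mathrm{int}(\mathcal{D})$, Lipschitz gradient constant $L_1(f)>0$ and constant Hessian ($L_2(f)=0$). Let $\{x_k\}$ be generated by Algorithm (a) (unconstrained) with $$\mu_k=\tfrac{1}{\tau(f)K}\ (k=1,\dots,K_0),\qquad \mu_k=\tfrac{2}{\tau(f)k}\ (k=K_0+1,\dots,K),\qquad \delta_k=\delta\ \text{for all }k,$$ where $K_0=\lfloor 4nL_1(f)^2/\tau(f)^2\rfloor$ and $\delta\in(0,\kappa\bar\delta]$ for some $\kappa\in(0,1)$, using the stochastic complex oracle with independent noise, and suppose $K\ge 2K_0$. Then for $\bar x_{K_0,K}=\frac{1}{K-K_0}\sum_{k=K_0+1}^Kx_k$, $$\mathbb{E}[f(\bar x_{K_0,K})-f(x^\star)]\le O\!\left(\frac{nL_1(f)^2}{\tau(f)}\|x_1-x^\star\|_2^2K^{-1}\right)+\widetilde O\!\left(\frac{n^2\sigma_\xi}{\tau(f)\delta^2}K^{-1}\right).$$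
   Context: Standing setup. $\mathcal{D}\subseteq\mathbb{R}^n$ open, $f:\mathcal{D}\to\mathbb{R}$ real-analytic. Holomorphic extension assumption: $f$ admits a holomorphic extension to $\{x+iy: x\in\mathcal{D}, y\in(-\bar\delta,\bar\delta)^n\}\subset\mathbb{C}^n$ for some $\bar\delta\in(0,1)$. Stochastic complex oracle: on query $z$ it returns $\Im(f(z))+\xi$, $\xi$ real, $\mathbb{E}[\xi]=0$, $\mathbb{E}[\xi^2]\le\sigma_\xi$ ($\sigma_\xi>0$), drawn independently of the random directions (fresh noise at each query). Algorithm 1 (a): given $x_1\in\mathcal{D}$, stepsizes $\{\mu_k\}$, smoothing parameters $\{\delta_k\}$, for $k=1,\dots,K$: draw $u_k$ uniformly on $\mathbb{S}^{n-1}$ (independently), set $g_{\delta_k}(x_k)=\frac{n}{\delta_k}\Im(f(x_k+i\delta_ku_k))u_k+\frac{n}{\delta_k}\xi_ku_k$ and $x_{k+1}=x_k-\mu_kg_{\delta_k}(x_k)$. $\tau(f)$-strong convexity: $f(y)\ge f(x)+\langle\nabla f(x),y-x\rangle+\tfrac12\tau(f)\|y-x\|_2^2$ for all $x,y\in\mathcal{D}$. Lipschitz gradient: $\|\nabla f(x)-\nabla f(y)\|_2\le L_1(f)\|x-y\|_2$. $O,\widetilde O$ constants are independent of $K$; $\widetilde O$ additionally hides factors logarithmic in $K$. *)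

(* Defs.v *)
From HB Require Import structures.
From mathcomp Require Import all_boot all_order all_algebra.
From mathcomp Require Import all_classical all_reals all_analysis.
From mathcomp Require Export complex.
Export Order.TTheory GRing.Theory Num.Theory.

Set Implicit Arguments.
Unset Strict Implicit.
Unset Printing Implicit Defensive.

Local Open Scope ring_scope.
Local Open Scope classical_set_scope.

Section Defs.
Variable R : realType.

Definition dotv (n : nat) (a b : 'rV[R]_n) : R := \sum_(i < n) a 0 i * b 0 i.

Definition norm2 (n : nat) (v : 'rV[R]_n) : R := Num.sqrt (dotv v v).

Definition grad (n : nat) (f : 'rV[R]_n -> R) (x : 'rV[R]_n) : 'rV[R]_n :=
  \row_(i < n) derive f x (delta_mx 0 i).

Definition sphere (n : nat) : set 'rV[R]_n := [set v | norm2 v = 1].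

Definition quad (n : nat) (A : 'M[R]_n) (b : 'rV[R]_n) (c : R)
  (x : 'rV[R]_n) : R :=
  (x *m A *m x^T) 0 0 / 2 + dotv b x + c.

Definition cvec (n : nat) (v : 'rV[R]_n) : 'rV[R[i]]_n :=
  map_mx (fun r : R => (r%:C)%C) v.

(** the (entire) holomorphic extension of [quad A b c] to C^n:
    z |-> 1/2 z A z^T + sum_i b_i z_i + c *)
Definition quadC (n : nat) (A : 'M[R]_n) (b : 'rV[R]_n) (c : R)
  (z : 'rV[R[i]]_n) : R[i] :=
  (z *m map_mx (fun r : R => (r%:C)%C) A *m z^T) 0 0 / 2
  + \sum_(i < n) ((b 0 i)%:C)%C * z 0 i + (c%:C)%C.

Definition cs_grad_est (n : nat) (F : 'rV[R[i]]_n -> R[i])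
  (delta : R) (u : 'rV[R]_n) (xi : R) (x : 'rV[R]_n) : 'rV[R]_n :=
  (n%:R / delta * complex.Im (F (cvec x + ('i%C * (delta%:C)%C) *: cvec u))) *: u
  + (n%:R / delta * xi) *: u.

(** iterates x_k (k >= 1) of Algorithm 1 (a):
    x_1 given, x_{k+1} = x_k - mu_k g_{delta_k}(x_k), where g uses the
    direction u_k and the noise xi_k.  (x_0 is set to x_1 and is unused.) *)
Fixpoint cs_iter (n : nat) (F : 'rV[R[i]]_n -> R[i]) (x1 : 'rV[R]_n)
  (mu delta : nat -> R) (u : nat -> 'rV[R]_n) (xi : nat -> R) (k : nat)
  : 'rV[R]_n :=
  match k with
  | 0 => x1
  | k'.+1 =>
      match k' with
      | 0 => x1
      | _ => let x := cs_iter F x1 mu delta u xi k' in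
             x - mu k' *: cs_grad_est F (delta k') (u k') (xi k') x
      end
  end.

Definition borel_rV (n : nat) : set (set 'rV[R]_n) :=
  <<s [set: 'rV[R]_n], [set S : set 'rV[R]_n | exists B : 'I_n -> set R,
                 (forall i, measurable (B i)) /\
                 S = [set v : 'rV[R]_n | forall i, B i (v 0 i)]] >>.

Variables (d : measure_display) (T : measurableType d).

Definition random_vector (n : nat) (u : T -> 'rV[R]_n) : Prop :=
  forall i : 'I_n, measurable_fun setT (fun w => u w 0 i).

(** u is uniformly distributed on the unit sphere S^{n-1}: its law is a
    probability concentrated on S^{n-1} and invariant under all orthogonal
    transformations (the normalized surface measure of S^{n-1} is the
    unique such law) *)
Definition uniform_on_sphere (P : probability T R) (n : nat)
  (u : T -> 'rV[R]_n) : Prop :=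
  random_vector u /\
  P [set w | @sphere n (u w)] = 1%E /\
  forall Q : 'M[R]_n, Q *m Q^T = 1%:M ->
    forall S, borel_rV S ->
      P [set w | S (u w *m Q)] = P [set w | S (u w)].

(** the 2K random elements u_1, ..., u_K, xi_1, ..., xi_K are mutually
    independent (product rule over Borel events; taking whole-space events
    for some indices yields the product rule for every subfamily) *)
Definition mutually_independent (P : probability T R) (n K : nat)
  (u : nat -> T -> 'rV[R]_n) (xi : nat -> T -> R) : Prop :=
  forall (S : nat -> set 'rV[R]_n) (B : nat -> set R),
    (forall k, borel_rV (S k)) -> (forall k, measurable (B k)) ->
    P [set w | forall k, (1 <= k <= K)%N -> S k (u k w) /\ B k (xi k w)]
    = (\prod_(1 <= k < K.+1)
         (P [set w | S k (u k w)] * P [set w | B k (xi k w)]))%E.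

End Defs.

(* Main.v *)
Require Import Defs.
From HB Require Import structures.
From mathcomp Require Import all_boot all_order all_algebra all_fingroup.
From mathcomp Require Import all_classical all_reals all_analysis.
From mathcomp Require Import measurable_realfun.
From mathcomp Require Import complex.
From mathcomp Require Import ring lra zify.
Import Order.TTheory GRing.Theory Num.Theory.
Import numFieldNormedType.Exports.
Local Open Scope ring_scope.
Local Open Scope classical_set_scope.

Set Implicit Arguments.
Unset Strict Implicit.
Unset Printing Implicit Defensive.

(** For a quadratic [f] with symmetrized Hessian [H], the imaginary part of
    [f (x + i delta u)] is exactly [delta <grad f x, u>], so the estimator is
    [n <grad f x, u> u + (n / delta) xi u]: it is unbiased, with second moment
    [n |grad f x|^2 + n^2 E(xi^2) / delta^2].  With [e_k = x_k - x*], [r_k = E |e_k|^2]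
    and [a_k = E <e_k H, e_k>] this gives
      [r_{k+1} <= r_k - 2 mu_k a_k + mu_k^2 (n L1^2 r_k + n^2 sigma / delta^2)].
    During the first [K0] steps [r_k] stays within [O(1/K)] of [r_1]; afterwards
    multiplying by [k] makes the recursion telescope, bounding the sum of the
    [a_k], and the convexity of [f] transfers the bound to the averaged iterate. *)

(** * Means and independence *)

(** The iterates are unconstrained and may leave [D]. Since [f] is quadratic and [D] is open,
    testing the hypotheses along short segments through the minimizer gives Hessian inequalities in
    every direction, and these hold wherever the iterates go. No conditional expectation appears.
    Each moment of a step is a finite sum of products of coordinates, one factor determined by the
    earlier rounds and one by the current round, so a product rule for means of independent
    variables suffices; it is obtained from pi-systems of events. Origin of [K0]: put
    [m = n L1^2 / tau^2]. With the step [2 / (tau k)], the part of the variance proportional to the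
    squared error becomes [(4 m / k) r_k] after multiplication by [k], and it is at most [r_k] once
    [k >= 4 m]; hence the switch at the integer part of [4 m]. Before the switch the step
    [1 / (tau K)] is harmless because [m <= K]. The bound [K0 <= 4 m] also produces the factor
    [n L1^2 / tau] of the initial error, and the additive noise, summed as [1/k], produces the
    logarithm. *)

Section Mean.
Context {R : realType} {d} {T : measurableType d} (P : probability T R).

(** Integrability and value travel together, so linearity and monotonicity of the mean leave no
    separate side conditions. *)
Definition has_mean (X : T -> R) (m : R) :=
  P.-integrable setT (EFin \o X) /\ (\int[P]_w (X w)%:E = m%:E)%E.

Lemma has_mean_eq X m m' : has_mean X m -> m = m' -> has_mean X m'.
Proof. by move=> + <-. Qed.

Lemma has_mean_measurable X m : has_mean X m -> measurable_fun setT X.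
Proof. by case=> /measurable_int /measurable_EFinP. Qed.

Lemma integrable_has_mean X : P.-integrable setT (EFin \o X) ->
  has_mean X (fine (\int[P]_w (X w)%:E)).
Proof. by move=> iX; split=> //; rewrite fineK//; exact: integrable_fin_num. Qed.

Lemma has_mean_cst c : has_mean (cst c) c.
Proof.
split; first exact: finite_measure_integrable_cst.
transitivity (\int[P]_w (cst c%:E) w)%E => //.
rewrite integral_cst//; transitivity (c%:E * 1)%E; last by rewrite mule1.
by congr (_ * _)%E; exact: probability_setT.
Qed.

Lemma has_meanD X Y mX mY : has_mean X mX -> has_mean Y mY ->
  has_mean (fun w => X w + Y w) (mX + mY).
Proof.
move=> [iX eX] [iY eY]; split.
  exact: (integrableD measurableT iX iY).
by rewrite EFinD -eX -eY -integralD_EFin.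
Qed.

Lemma has_meanZ a X m : has_mean X m -> has_mean (fun w => a * X w) (a * m).
Proof.
move=> [iX eX]; split; first exact: (integrableZl measurableT a iX).
by rewrite EFinM -eX -integralZl.
Qed.

Lemma has_mean_sum (I : eqType) (s : seq I) (X : I -> T -> R) (m : I -> R) :
  (forall i, i \in s -> has_mean (X i) (m i)) ->
  has_mean (fun w => \sum_(i <- s) X i w) (\sum_(i <- s) m i).
Proof.
elim: s => [_|i s ih h].
  by rewrite big_nil; under eq_fun do rewrite big_nil; exact: has_mean_cst.
rewrite big_cons; under eq_fun do rewrite big_cons.
apply: has_meanD; first by apply: h; rewrite mem_head.
by apply: ih => j js; apply: h; rewrite in_cons js orbT.
Qed.

Lemma has_mean_le (X Y : T -> R) mX mY : has_mean X mX -> has_mean Y mY ->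
  (forall w, X w <= Y w) -> mX <= mY.
Proof.
move=> [iX eX] [iY eY] XY; rewrite -lee_fin -eX -eY.
by apply: le_integral => // w _; rewrite lee_fin.
Qed.

Lemma has_mean_ae (X Y : T -> R) m : measurable_fun setT Y ->
  {ae P, forall w, X w = Y w} -> has_mean X m -> has_mean Y m.
Proof.
move=> mY XY [iX eX]; have mX := measurable_int _ iX.
have ae : ae_eq P setT (EFin \o X) (EFin \o Y).
  by apply: filterS XY => w /= -> .
have mY' : measurable_fun setT (EFin \o Y) by exact/measurable_EFinP.
split.
  apply/integrableP; split=> //.
  have <- : (\int[P]_w `|(EFin \o X) w| = \int[P]_w `|(EFin \o Y) w|)%E.
    apply: (ae_eq_integral (abse \o (EFin \o Y))) => //.
    - exact: measurableT_comp.
    - exact: measurableT_comp.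
    - by apply: filterS XY => w /= ->.
  by case/integrableP : iX.
by rewrite -eX; apply/esym/ae_eq_integral.
Qed.

Lemma has_mean_dominated (X Y : T -> R) mY : measurable_fun setT X ->
  has_mean Y mY -> (forall w, `|X w| <= Y w) -> exists m, has_mean X m.
Proof.
move=> mX [iY _] XY; eexists; apply: integrable_has_mean.
apply: (le_integrable measurableT _ _ iY); first exact/measurable_EFinP.
by move=> w _ /=; rewrite lee_fin (le_trans (XY w))// ler_norm.
Qed.

(** The law of the pair [(X, Y)] agrees with the product of the marginal laws on rectangles, hence
    everywhere by uniqueness of the product measure; Fubini then factors the integral of [x * y]. *)
Lemma has_mean_indepM (X Y : T -> R) mX mY :
  (forall A B, measurable A -> measurable B ->
    P (X @^-1` A `&` Y @^-1` B) = (P (X @^-1` A) * P (Y @^-1` B))%E) ->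
  has_mean X mX -> has_mean Y mY ->
  has_mean (fun w => X w * Y w) (mX * mY).
Proof.
move=> XY hX hY.
have mXf := has_mean_measurable hX; have mYf := has_mean_measurable hY.
have [iX eX] := hX; have [iY eY] := hY.
pose X' : {mfun T >-> R} := HB.pack X (isMeasurableFun.Build _ _ _ _ _ mXf).
pose Y' : {mfun T >-> R} := HB.pack Y (isMeasurableFun.Build _ _ _ _ _ mYf).
have mZ : measurable_fun setT (fun w => (X w, Y w)).
  exact: measurable_fun_pair.
pose Z' : {mfun T >-> (R * R)%type} :=
  HB.pack (fun w => (X w, Y w)) (isMeasurableFun.Build _ _ _ _ _ mZ).
pose muX := distribution P X'; pose muY := distribution P Y'.
have ZE A : measurable A -> (muX \x muY)%E A = distribution P Z' A.
  by apply: product_measure_unique => B C mB mC; exact: XY.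
pose f (z : R * R) := (z.1 * z.2)%:E : \bar R.
have mf : measurable_fun setT f.
  by apply/measurable_EFinP; apply: measurable_funM.
have iX1 : (\int[muX]_x `|x%:E| = \int[P]_w `|(X w)%:E|)%E.
  rewrite ge0_integral_distribution//.
  by apply: measurableT_comp => //; exact/measurable_EFinP.
have iY1 : (\int[muY]_x `|x%:E| = \int[P]_w `|(Y w)%:E|)%E.
  rewrite ge0_integral_distribution//.
  by apply: measurableT_comp => //; exact/measurable_EFinP.
have iXX : muX.-integrable setT (EFin : R -> \bar R).
  apply/integrableP; split; first exact/measurable_EFinP.
  by rewrite iX1; case/integrableP : iX.
have iYY : muY.-integrable setT (EFin : R -> \bar R).
  apply/integrableP; split; first exact/measurable_EFinP.
  by rewrite iY1; case/integrableP : iY.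
(* Tonelli: the iterated integral of [|x| |y|] is the product of the first absolute moments, both
   finite. *)
have if_ : (muX \x muY)%E.-integrable setT f.
  apply/integrable12ltyP => //.
  have fE x y : (`|f (x, y)| = `|x%:E| * `|y%:E|)%E by rewrite /f EFinM abseM.
  have mabs : measurable_fun setT (fun x : R => `|x%:E|%E).
    by apply: measurableT_comp => //; exact/measurable_EFinP.
  under eq_integral.
    move=> x _; under eq_integral do rewrite fE.
    rewrite ge0_integralZl//; over.
  rewrite /= ge0_integralZr//; last exact: integral_ge0.
  by apply: lte_mul_pinfty; [exact: integral_ge0| |];
    rewrite ?iX1 ?iY1 ?ge0_fin_numE ?integral_ge0//;
    [case/integrableP: iX|case/integrableP: iY].
have iZ : P.-integrable setT (f \o Z').
  apply/integrableP; split; first exact: measurableT_comp.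
  have -> : (\int[P]_x `|(f \o Z') x| = \int[distribution P Z']_z `|f z|)%E.
    by rewrite ge0_integral_distribution//; exact: measurableT_comp.
  rewrite (@eq_measure_integral _ _ _ _ (muX \x muY)%E).
    by case/integrableP : if_.
  by move=> A mA _; apply/esym/ZE.
split; first exact: iZ.
rewrite -[LHS](integral_distribution mf iZ).
rewrite (@eq_measure_integral _ _ _ _ (muX \x muY)%E); last first.
  by move=> A mA _; apply/esym/ZE.
rewrite -(integral12_prod_meas1 if_) /fubini_F /f /=.
under eq_integral.
  move=> x _; under eq_integral do rewrite EFinM.
  rewrite integralZl//; over.
rewrite /=.
have -> : (\int[muY]_y y%:E = mY%:E)%E.
  by rewrite -eY integral_distribution//; exact/measurable_EFinP.
rewrite integralZr// EFinM; congr (_ * _)%E.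
by rewrite -eX integral_distribution//; exact/measurable_EFinP.
Qed.

End Mean.

Section Independence.
Context {R : realType} {d} {T : measurableType d} (P : probability T R).

Definition indep_systems (G H : set (set T)) :=
  forall E F, G E -> H F -> P (E `&` F) = (P E * P F)%E.

Lemma indep_systemsC G H : indep_systems G H -> indep_systems H G.
Proof. by move=> GH E F HE GF; rewrite setIC muleC GH. Qed.

(* As functions of [E], [P (E `&` F)] and [P E * P F] are finite measures that
   agree on the pi-system [G], hence on the sigma-algebra it generates. *)
Lemma indep_systems_sigma G H :
  setI_closed G -> G setT -> G `<=` measurable -> H `<=` measurable ->
  indep_systems G H -> indep_systems <<s G >> H.
Proof.
move=> GI GT Gm Hm GH E F sE HF.
have mF := Hm _ HF.
have PF0 : 0 <= fine (P F) by exact: fine_ge0.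
pose m1 := mrestr P mF.
pose m2 := mscale (NngNum PF0) P.
have -> : P (E `&` F) = m1 E by [].
have PFE : (fine (P F))%:E = P F by rewrite fineK// fin_num_measure.
have -> : (P E * P F)%E = m2 E by rewrite /m2 /mscale /= PFE muleC.
apply: (g_sigma_algebra_measure_unique G Gm (fun=> setT)) => //.
- by rewrite bigcup_const.
- move=> A GA; transitivity (P F * P A)%E; first by rewrite muleC -GH.
  by congr (_ * _)%E; exact: esym PFE.
- by move=> _; rewrite /m1/= /mrestr setTI -ge0_fin_numE// fin_num_measure.
Qed.

(** This replaces conditioning on the past: [G] will be the events of earlier rounds and [H] those
    of the current one. Independence is extended to the generated sigma-algebras one side at a time,
    with a swap in between. *)
Lemma has_mean_sigma_indepM (G H : set (set T)) (X Y : T -> R) mX mY :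
  setI_closed G -> G setT -> G `<=` measurable ->
  setI_closed H -> H setT -> H `<=` measurable ->
  indep_systems G H ->
  measurable_fun (setT : set (g_sigma_algebraType G)) X ->
  measurable_fun (setT : set (g_sigma_algebraType H)) Y ->
  has_mean P X mX -> has_mean P Y mY ->
  has_mean P (fun w => X w * Y w) (mX * mY).
Proof.
move=> GI GT Gm HI HT Hm GH mX' mY'; apply: has_mean_indepM => A B mA mB.
have sGm : <<s G >> `<=` measurable.
  by apply: smallest_sub => //; exact: sigma_algebra_measurable.
apply: (indep_systemsC (indep_systems_sigma HI HT Hm sGm _)).
- exact/indep_systemsC/indep_systems_sigma.
- by have := mX' measurableT _ mA; rewrite setTI.
- by have := mY' measurableT _ mB; rewrite setTI.
Qed.

End Independence.

(** * Uniform directions on the sphere *)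

Section Dotv.
Context {R : realType} {n : nat}.
Implicit Types a b c : 'rV[R]_n.

Lemma dotvC a b : dotv a b = dotv b a.
Proof. by apply: eq_bigr => i _; rewrite mulrC. Qed.

Lemma dotvDl a b c : dotv (a + b) c = dotv a c + dotv b c.
Proof. by rewrite /dotv -big_split; apply: eq_bigr => i _; rewrite mxE mulrDl. Qed.

Lemma dotvZl k a b : dotv (k *: a) b = k * dotv a b.
Proof. by rewrite /dotv big_distrr; apply: eq_bigr => i _; rewrite mxE -mulrA. Qed.

Lemma dotvDr a b c : dotv a (b + c) = dotv a b + dotv a c.
Proof. by rewrite dotvC dotvDl !(dotvC a). Qed.

Lemma dotvZr k a b : dotv a (k *: b) = k * dotv a b.
Proof. by rewrite dotvC dotvZl (dotvC a). Qed.

Lemma dotvNl a b : dotv (- a) b = - dotv a b.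
Proof. by rewrite -scaleN1r dotvZl mulN1r. Qed.

Lemma dotvNr a b : dotv a (- b) = - dotv a b.
Proof. by rewrite dotvC dotvNl dotvC. Qed.

Definition dotvE := (dotvDl, dotvDr, dotvZl, dotvZr, dotvNl, dotvNr).

Lemma dotv_mx a b : dotv a b = (a *m b^T) 0 0.
Proof. by rewrite mxE; apply: eq_bigr => i _; rewrite mxE. Qed.

Lemma dotv_mulmxl a b (M : 'M[R]_n) : dotv (a *m M) b = dotv a (b *m M^T).
Proof. by rewrite !dotv_mx trmx_mul trmxK mulmxA. Qed.

Lemma dotv_ge0 a : 0 <= dotv a a.
Proof. by apply: sumr_ge0 => i _; rewrite -expr2 sqr_ge0. Qed.

Lemma norm2_sqr a : norm2 a ^+ 2 = dotv a a.
Proof. by rewrite sqr_sqrtr// dotv_ge0. Qed.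

Lemma coord_sqr_le a i : a 0 i ^+ 2 <= dotv a a.
Proof.
rewrite /dotv (bigD1 i)//= -expr2 lerDl.
by apply: sumr_ge0 => j _; rewrite -expr2 sqr_ge0.
Qed.

(** The domination that makes every product of two coordinates integrable as soon as both squared
    norms are. *)
Lemma coordM_le a b i j : `|a 0 i * b 0 j| <= dotv a a + dotv b b.
Proof.
have ha := coord_sqr_le a i; have hb := coord_sqr_le b j.
have := sqr_ge0 (a 0 i - b 0 j); have := sqr_ge0 (a 0 i + b 0 j).
have := sqr_ge0 (a 0 i); have := sqr_ge0 (b 0 j).
move: ha hb; set p := dotv a a; set q := dotv b b.
move: (a 0 i) (b 0 j) => x y.
by rewrite ler_norml => *; apply/andP; split; nra.
Qed.

End Dotv.

Section RandomVectors.
Context {R : realType} {d} {T : measurableType d} {n : nat}.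
Implicit Types a b : T -> 'rV[R]_n.

Lemma random_vector_cst (v : 'rV[R]_n) : random_vector (fun _ : T => v).
Proof. by move=> i; exact: measurable_cst. Qed.

Lemma random_vectorD a b : random_vector a -> random_vector b ->
  random_vector (fun w => a w + b w).
Proof.
move=> ma mb i; under eq_fun do rewrite mxE.
exact: measurable_funD (ma i) (mb i).
Qed.

Lemma random_vectorZ (c : T -> R) a : measurable_fun setT c ->
  random_vector a -> random_vector (fun w => c w *: a w).
Proof.
move=> mc ma i; under eq_fun do rewrite mxE.
exact: measurable_funM mc (ma i).
Qed.

Lemma random_vectorN a : random_vector a -> random_vector (fun w => - a w).
Proof.
move=> ma; under eq_fun do rewrite -scaleN1r.
by apply: random_vectorZ.
Qed.

Lemma random_vector_mulmx a (M : 'M[R]_n) : random_vector a ->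
  random_vector (fun w => a w *m M).
Proof.
move=> ma i; under eq_fun do rewrite mxE.
by apply: measurable_sum => j; apply: measurable_funM.
Qed.

Lemma measurable_dotv a b : random_vector a -> random_vector b ->
  measurable_fun setT (fun w => dotv (a w) (b w)).
Proof.
move=> ma mb; rewrite /dotv; apply: measurable_sum => j.
exact: measurable_funM (ma j) (mb j).
Qed.

Lemma random_vector_sum (I : eqType) (s : seq I) (a : I -> T -> 'rV[R]_n) :
  (forall k, k \in s -> random_vector (a k)) ->
  random_vector (fun w => \sum_(k <- s) a k w).
Proof.
elim: s => [_|k s ih h].
  by under eq_fun do rewrite big_nil; exact: random_vector_cst.
under eq_fun do rewrite big_cons.
apply: random_vectorD; first by apply: h; rewrite mem_head.
by apply: ih => j js; apply: h; rewrite in_cons js orbT.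
Qed.

(** The generators of [borel_rV] under a name, so that [g_sigma_algebraType] turns row vectors into
    a measurable space whose measurable sets are the [borel_rV] ones. *)
Definition rV_boxes : set (set 'rV[R]_n) :=
  [set S : set 'rV[R]_n | exists B : 'I_n -> set R,
    (forall i, measurable (B i)) /\ S = [set v : 'rV[R]_n | forall i, B i (v 0 i)]].

Lemma borel_coord (B : set R) i : measurable B ->
  borel_rV [set v : 'rV[R]_n | B (v 0 i)].
Proof.
move=> mB; apply: sub_sigma_algebra.
exists (fun j => if j == i then B else setT); split.
  by move=> j; case: ifP.
apply/seteqP; split => v /=; first by move=> Bv j; case: eqP => [->|].
by move=> /(_ i); rewrite eqxx.
Qed.

Lemma random_vector_preimage a (S : set 'rV[R]_n) : random_vector a ->
  borel_rV S -> measurable [set w | S (a w)].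
Proof.
move=> ma bS.
have : measurable_fun setT (a : T -> g_sigma_algebraType rV_boxes).
  apply: (@measurability _ _ T (g_sigma_algebraType rV_boxes) _ _ rV_boxes) => // _ [_ [B [mB ->]] <-].
  rewrite setTI.
  have -> : a @^-1` [set v | forall i, B i (v 0 i)] =
      \bigcap_(i in [set` 'I_n]) ((fun w => a w 0 i) @^-1` B i).
    by apply/seteqP; split=> w /= h i; [move=> _|]; exact: h.
  apply: fin_bigcap_measurable => // i _.
  by rewrite -[X in measurable X]setTI; exact: ma.
by move=> /(_ measurableT S bS); rewrite setTI.
Qed.

End RandomVectors.

Lemma measurable_coord_rV (R : realType) n (i : 'I_n) :
  measurable_fun (setT : set (g_sigma_algebraType (@rV_boxes R n)))
    (fun v : 'rV[R]_n => v 0 i).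
Proof. by move=> _ B mB; rewrite setTI; exact: borel_coord. Qed.

Section Sphere.
Context {R : realType} {d} {T : measurableType d} (P : probability T R).

Lemma has_mean_unique (X : T -> R) m m' :
  has_mean P X m -> has_mean P X m' -> m = m'.
Proof. by move=> [_ e] [_ e']; apply: EFin_inj; rewrite -e. Qed.

Lemma has_mean_same_law (X Y : T -> R) m : measurable_fun setT Y ->
  (forall A, measurable A -> P (X @^-1` A) = P (Y @^-1` A)) ->
  has_mean P X m -> has_mean P Y m.
Proof.
move=> mYf XY hX.
have mXf := has_mean_measurable hX; have [iX eX] := hX.
pose X' : {mfun T >-> R} := HB.pack X (isMeasurableFun.Build _ _ _ _ _ mXf).
pose Y' : {mfun T >-> R} := HB.pack Y (isMeasurableFun.Build _ _ _ _ _ mYf).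
have mE : measurable_fun setT (EFin : R -> \bar R) by exact/measurable_EFinP.
have iY : P.-integrable setT (EFin \o Y).
  apply/integrableP; split; first exact/measurable_EFinP.
  have mE' : measurable_fun setT (fun x : R => `|x%:E|%E).
    exact: measurableT_comp.
  have -> : (\int[P]_x `|(EFin \o Y) x| = \int[distribution P Y']_z `|z%:E|)%E.
    by rewrite ge0_integral_distribution.
  rewrite (@eq_measure_integral _ _ _ _ (distribution P X')).
    by rewrite ge0_integral_distribution//; case/integrableP : iX.
  by move=> A mA _; apply/esym/XY.
split=> //.
rewrite -[LHS](@integral_distribution _ _ _ _ _ P Y' EFin)//.
rewrite (@eq_measure_integral _ _ _ _ (distribution P X')).
  by rewrite integral_distribution.
by move=> A mA _; apply/esym/XY.
Qed.

Context {n : nat} (u : T -> 'rV[R]_n).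
Hypothesis uu : uniform_on_sphere P u.

Lemma uniform_random_vector : random_vector u. Proof. by case: uu. Qed.

Lemma uniform_dotv1 : {ae P, forall w, dotv (u w) (u w) = 1}.
Proof.
have mu_ := uniform_random_vector; case: uu => _ [P1 _].
have md : measurable_fun setT (fun w => dotv (u w) (u w)).
  exact: measurable_dotv.
have mE : measurable [set w | @sphere R n (u w)].
  have -> : [set w | @sphere R n (u w)] =
      (fun w => dotv (u w) (u w)) @^-1` [set 1].
    apply/seteqP; split=> w; rewrite /sphere /=.
      by move=> h; rewrite -norm2_sqr h expr1n.
    by rewrite /norm2 => ->; rewrite sqrtr1.
  by rewrite -[X in measurable X]setTI; exact: md.
exists (~` [set w | @sphere R n (u w)]); split.
- exact: measurableC.
- by rewrite probability_setC// [X in (_ - X)%E]P1 subee.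
- apply: subsetC => w; rewrite /sphere /= => h.
  by rewrite -norm2_sqr h expr1n.
Qed.

(** Orthogonal invariance is assumed for events only; applied to the preimages of [g] it says that
    [g (u Q)] and [g u] have the same law on the reals, hence the same mean. *)
Lemma uniform_orthogonal (g : 'rV[R]_n -> R) (Q : 'M[R]_n) m :
  measurable_fun (setT : set (g_sigma_algebraType (@rV_boxes R n))) g ->
  Q *m Q^T = 1%:M -> has_mean P (fun w => g (u w)) m ->
  has_mean P (fun w => g (u w *m Q)) m.
Proof.
move=> mg QQ.
have bg A : measurable A -> borel_rV (g @^-1` A).
  by move=> mA; have := mg measurableT A mA; rewrite setTI.
have muQ := random_vector_mulmx Q uniform_random_vector.
apply: has_mean_same_law.
  move=> _ A mA; rewrite setTI.
  exact: (random_vector_preimage muQ (bg _ mA)).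
move=> A mA; case: uu => _ [_ inv]; apply/esym.
exact: (inv Q QQ _ (bg _ mA)).
Qed.

(* Exchanging two coordinates shows that all [E u_i^2] agree, and they sum to 1;
   flipping the sign of one coordinate gives [E u_i u_j = - E u_i u_j]. *)
Lemma uniform_second_moment i j :
  has_mean P (fun w => u w 0 i * u w 0 j) ((i == j)%:R / n%:R).
Proof.
have mu_ := uniform_random_vector.
have h1 : has_mean P (fun w => dotv (u w) (u w)) 1.
  apply: has_mean_ae (has_mean_cst P 1); first exact: measurable_dotv.
  by apply: filterS uniform_dotv1 => w ->.
have ex k l : exists m, has_mean P (fun w => u w 0 k * u w 0 l) m.
  apply: (has_mean_dominated _ (has_meanD h1 h1)).
    exact: measurable_funM.
  by move=> w; exact: coordM_le.
have [M hM] : exists M : 'I_n -> 'I_n -> R,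
    forall k l, has_mean P (fun w => u w 0 k * u w 0 l) (M k l).
  exists (fun k l => projT1 (cid (ex k l))) => k l.
  exact: projT2 (cid (ex k l)).
have mm k l : measurable_fun (setT : set (g_sigma_algebraType (@rV_boxes R n)))
    (fun v : 'rV[R]_n => v 0 k * v 0 l).
  by apply: measurable_funM; exact: measurable_coord_rV.
have diag k l : M k k = M l l.
  pose s := tperm k l.
  have QQ : perm_mx s^-1 *m (perm_mx s^-1)^T = 1%:M :> 'M[R]_n.
    by rewrite tr_perm_mx -perm_mxM invgK mulVg perm_mx1.
  have := uniform_orthogonal (mm k k) QQ (hM k k).
  under eq_fun do rewrite -col_permE !mxE tpermL.
  by move=> /has_mean_unique; apply.
have off k l : k != l -> M k l = 0.
  move=> kl; pose D : 'rV[R]_n := \row_i (if i == k then -1 else 1).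
  have QQ : diag_mx D *m (diag_mx D)^T = 1%:M :> 'M[R]_n.
    rewrite tr_diag_mx mul_mx_diag; apply/matrixP => x y; rewrite !mxE.
    case: (eqVneq x y) => [->|_]; last by rewrite !mulr0n mul0r.
    by rewrite !mulr1n; case: ifP => _; rewrite ?mulrNN mulr1.
  have := uniform_orthogonal (mm k l) QQ (hM k l).
  under eq_fun do rewrite mul_mx_diag !mxE eqxx eq_sym (negbTE kl) mulr1 mulrN1 mulNr -mulN1r.
  move=> /has_mean_unique /(_ (has_meanZ (-1) (hM k l))).
  by move=> h; lra.
have tr : \sum_k M k k = 1.
  by apply: has_mean_unique h1; apply: has_mean_sum => k _; exact: hM.
apply: has_mean_eq (hM i j) _.
case: (eqVneq i j) => [<-|ij]; last by rewrite mul0r off.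
have n0 : n%:R != 0 :> R by rewrite pnatr_eq0; case: (n) i => [[]|].
have e : n%:R * M i i = 1.
  rewrite -[RHS]tr (eq_bigr (fun=> M i i)) ?sumr_const ?card_ord ?mulr_natl //.
by rewrite -[LHS](mulKf n0) e mulrC.
Qed.

End Sphere.

(** * One step of the stochastic recursion *)

Section Boxes.
Context {R : realType} {d} {T : measurableType d} (P : probability T R).
Context {n : nat} (K : nat) (u : nat -> T -> 'rV[R]_n) (xi : nat -> T -> R).
Implicit Types (I J : pred nat) (S : nat -> set 'rV[R]_n) (B : nat -> set R).

Definition box I S B : set T :=
  [set w | forall j, I j -> S j (u j w) /\ B j (xi j w)].

(** A pi-system generating the sigma-algebra of the rounds in [I], made of events whose probability
    the product rule of [mutually_independent] gives directly. *)
Definition boxes I : set (set T) := [set E | exists S B,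
  (forall j, borel_rV (S j)) /\ (forall j, measurable (B j)) /\ E = box I S B].

Lemma borel_rVT : borel_rV [set: 'rV[R]_n].
Proof. exact: (@measurableT _ (g_sigma_algebraType (@rV_boxes R n))). Qed.

Lemma borel_rVI (S S' : set 'rV[R]_n) :
  borel_rV S -> borel_rV S' -> borel_rV (S `&` S').
Proof. exact: (@measurableI _ (g_sigma_algebraType (@rV_boxes R n))). Qed.

Lemma boxes_setI I : setI_closed (boxes I).
Proof.
move=> _ _ [S [B [bS [mB ->]]]] [S' [B' [bS' [mB' ->]]]].
exists (fun j => S j `&` S' j), (fun j => B j `&` B' j); split.
  by move=> j; exact: borel_rVI.
split; first by move=> j; exact: measurableI.
apply/seteqP; split=> w /=.
  by move=> [h h'] j Ij; have [? ?] := h j Ij; have [? ?] := h' j Ij.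
by move=> h; split=> j /h [[? ?] [? ?]].
Qed.

Lemma boxes_setT I : boxes I setT.
Proof.
exists (fun=> setT), (fun=> setT); split; first by move=> _; exact: borel_rVT.
by split=> //; apply/seteqP; split.
Qed.

Lemma boxesS I J : {subset I <= J} -> boxes I `<=` boxes J.
Proof.
move=> IJ _ [S [B [bS [mB ->]]]].
exists (fun j => if I j then S j else setT), (fun j => if I j then B j else setT).
split; first by move=> j; case: ifP => _ //; exact: borel_rVT.
split; first by move=> j; case: ifP.
apply/seteqP; split=> w /= h j.
  by move=> _; case: ifP => // /h.
by move=> Ij; have := h j (IJ j Ij); rewrite Ij.
Qed.

Lemma measurable_boxesS I J (X : T -> R) : {subset I <= J} ->
  measurable_fun (setT : set (g_sigma_algebraType (boxes I))) X ->
  measurable_fun (setT : set (g_sigma_algebraType (boxes J))) X.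
Proof.
move=> IJ mX _ A mA; have := mX measurableT A mA.
apply: smallest_sub; first exact: smallest_sigma_algebra.
by apply: subset_trans (boxesS IJ) _; exact: sub_sigma_algebra.
Qed.

Lemma random_vector_boxes I j : I j ->
  @random_vector R _ (g_sigma_algebraType (boxes I)) n (u j).
Proof.
move=> Ij i _ A mA; apply: sub_sigma_algebra; rewrite setTI.
exists (fun l => if l == j then [set v | A (v 0 i)] else setT), (fun=> setT).
split; first by move=> l; case: ifP => _; [exact: borel_coord|exact: borel_rVT].
split=> //; apply/seteqP; split=> w /=.
  by move=> Aw l Il; split=> //; case: eqP => // ->.
by move=> /(_ j Ij) []; rewrite eqxx.
Qed.

Lemma measurable_noise_boxes I j : I j ->
  measurable_fun (setT : set (g_sigma_algebraType (boxes I))) (xi j).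
Proof.
move=> Ij _ A mA; apply: sub_sigma_algebra; rewrite setTI.
exists (fun=> setT), (fun l => if l == j then A else setT).
split; first by move=> l; exact: borel_rVT.
split; first by move=> l; case: ifP.
apply/seteqP; split=> w /=.
  by move=> Aw l Il; split=> //; case: eqP => // ->.
by move=> /(_ j Ij) [_]; rewrite eqxx.
Qed.

Hypothesis mu_ : forall k, (1 <= k <= K)%N -> random_vector (u k).
Hypothesis mxi : forall k, (1 <= k <= K)%N -> measurable_fun setT (xi k).
Hypothesis ind : mutually_independent P K u xi.

Lemma boxes_measurable I : (forall j, I j -> (1 <= j <= K)%N) ->
  boxes I `<=` measurable.
Proof.
move=> IK _ [S [B [bS [mB ->]]]].
have -> : box I S B = \bigcap_j
    (if I j then [set w | S j (u j w)] `&` (xi j @^-1` B j) else setT).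
  apply/seteqP; split=> w /= h j; first by move=> _; case: ifP => // /h.
  by move=> Ij; have := h j Logic.I; rewrite Ij.
apply: bigcapT_measurable => j; case: ifP => // /IK jK.
apply: measurableI; first exact: random_vector_preimage (mu_ jK) (bS j).
by rewrite -[X in measurable X]setTI; exact: mxi.
Qed.

(** Rounds outside [I] are padded with whole spaces, so that the product rule over all [K] rounds
    applies; their factors are then 1. *)
Lemma box_prob I S B : (forall j, I j -> (1 <= j <= K)%N) ->
  (forall j, borel_rV (S j)) -> (forall j, measurable (B j)) ->
  P (box I S B) = (\prod_(1 <= j < K.+1 | I j)
    (P [set w | S j (u j w)] * P [set w | B j (xi j w)]))%E.
Proof.
move=> IK bS mB.
pose S' j := if I j then S j else setT.
pose B' j := if I j then B j else setT.
have bS' j : borel_rV (S' j) by rewrite /S'; case: ifP => // _; exact: borel_rVT.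
have mB' j : measurable (B' j) by rewrite /B'; case: ifP.
have -> : box I S B = [set w | forall k, (1 <= k <= K)%N ->
    S' k (u k w) /\ B' k (xi k w)].
  apply/seteqP; split=> w /= h j; rewrite /S' /B'.
    by move=> _; case: ifP => // /h.
  by move=> Ij; have := h j (IK j Ij); rewrite /S' /B' Ij.
rewrite ind// [RHS]big_mkcond; apply: eq_bigr => j _.
rewrite /S' /B'; case: ifP => // _.
have PT : P setT = 1%E by exact: probability_setT.
by rewrite -[RHS]mule1; congr (_ * _)%E; rewrite -PT; congr (P _);
  apply/seteqP; split.
Qed.

(** A box over [I] meets a box over the disjoint [J] in a single box over their union, whose sides
    come from one or the other; the product of probabilities splits accordingly. *)
Lemma boxes_indep I J : (forall j, I j -> (1 <= j <= K)%N) ->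
  (forall j, J j -> (1 <= j <= K)%N) -> (forall j, I j -> J j -> false) ->
  indep_systems P (boxes I) (boxes J).
Proof.
move=> IK JK IJ _ _ [S [B [bS [mB ->]]]] [S' [B' [bS' [mB' ->]]]].
pose S2 j := if I j then S j else S' j.
pose B2 j := if I j then B j else B' j.
have -> : box I S B `&` box J S' B' = box [pred j | I j || J j] S2 B2.
  apply/seteqP; split=> w /=.
    move=> [h h'] j /orP IJj; rewrite /S2 /B2; case: ifP => [/h//|nI].
    by case: IJj => [|/h'//]; rewrite nI.
  move=> h; split=> j Hj; have := h j; rewrite /S2 /B2 /= Hj ?orbT.
    by apply.
  by case: ifP => [Ij|_]; [have := IJ j Ij Hj|apply].
rewrite !box_prob//; last 3 first.
- by move=> j /orP[/IK|/JK].
- by move=> j; rewrite /S2; case: ifP.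
- by move=> j; rewrite /B2; case: ifP.
rewrite big_mkcond [in RHS]big_mkcond [X in (_ * X)%E]big_mkcond.
rewrite -big_split; apply: eq_bigr => j _; rewrite /= /S2 /B2.
case: (boolP (I j)) => Ij /=; last by rewrite mul1e.
by case: (boolP (J j)) => Jj; [have := IJ j Ij Jj|rewrite mule1].
Qed.

(** Independence inside one round: the product rule for a box constraining round [k] alone has one
    nontrivial factor, itself a product of a direction probability and a noise probability. *)
Lemma direction_noise_indep k (g : 'rV[R]_n -> R) (A B : set R) : (1 <= k <= K)%N ->
  measurable_fun (setT : set (g_sigma_algebraType (@rV_boxes R n))) g ->
  measurable A -> measurable B ->
  P ((fun w => g (u k w)) @^-1` A `&` xi k @^-1` B) =
  (P ((fun w => g (u k w)) @^-1` A) * P (xi k @^-1` B))%E.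
Proof.
move=> kK mg mA mB.
have bg : borel_rV (g @^-1` A) by have := mg measurableT A mA; rewrite setTI.
transitivity (P (box (pred1 k) (fun=> g @^-1` A) (fun=> B))).
  congr (P _); apply/seteqP; split=> w /=; first by move=> h j /eqP ->.
  by move=> /(_ k (eqxx k)).
rewrite box_prob//; last by move=> j /eqP ->.
rewrite (big_rem k) /=; last by rewrite mem_index_iota.
rewrite eqxx big1_seq ?mule1// => j /andP[/eqP ->].
by rewrite mem_rem_uniq ?iota_uniq// inE eqxx.
Qed.

End Boxes.

Lemma measurable_sub_system (R : realType) d (T : measurableType d)
    (G : set (set T)) (X : T -> R) : G `<=` measurable ->
  measurable_fun (setT : set (g_sigma_algebraType G)) X ->
  measurable_fun setT X.
Proof.
move=> Gm mX _ A mA; have := mX measurableT A mA.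
by apply: smallest_sub => //; exact: sigma_algebra_measurable.
Qed.

Section Step.
Context {R : realType} {d} {T : measurableType d} (P : probability T R).
Context {n : nat}.
Implicit Types e a b : T -> 'rV[R]_n.

Lemma has_mean_coordM a b ma mb i j : random_vector a -> random_vector b ->
  has_mean P (fun w => dotv (a w) (a w)) ma ->
  has_mean P (fun w => dotv (b w) (b w)) mb ->
  exists m, has_mean P (fun w => a w 0 i * b w 0 j) m.
Proof.
move=> ra rb ha hb; apply: (has_mean_dominated _ (has_meanD ha hb)).
  exact: measurable_funM.
by move=> w; exact: coordM_le.
Qed.

Lemma has_mean_coord a ma i : random_vector a ->
  has_mean P (fun w => dotv (a w) (a w)) ma ->
  exists m, has_mean P (fun w => a w 0 i) m.
Proof.
move=> ra ha; apply: (has_mean_dominated _ (has_meanD (has_mean_cst P 1) ha)).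
  exact: ra.
move=> w; have := coord_sqr_le (a w) i => /=.
by rewrite ler_norml => h; apply/andP; split; nra.
Qed.

Lemma has_mean_dotv a b ma mb : random_vector a -> random_vector b ->
  has_mean P (fun w => dotv (a w) (a w)) ma ->
  has_mean P (fun w => dotv (b w) (b w)) mb ->
  exists m, has_mean P (fun w => dotv (a w) (b w)) m.
Proof.
move=> ra rb ha hb.
exists (\sum_i projT1 (cid (has_mean_coordM i i ra rb ha hb))).
by apply: has_mean_sum => i _; exact: projT2 (cid _).
Qed.

Lemma has_mean_mulmx a ma (M : 'M[R]_n) : random_vector a ->
  has_mean P (fun w => dotv (a w) (a w)) ma ->
  exists m, has_mean P (fun w => dotv (a w *m M) (a w *m M)) m.
Proof.
move=> ra ha; pose N := M *m M^T.
have h i j := cid (has_mean_coordM i j ra ra ha ha).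
exists (\sum_j \sum_i N i j * projT1 (h i j)).
have -> : (fun w => dotv (a w *m M) (a w *m M)) =
    (fun w => \sum_j \sum_i N i j * (a w 0 i * a w 0 j)).
  apply/funext => w; rewrite dotv_mulmxl -mulmxA.
  apply: eq_bigr => j _; rewrite mxE big_distrr.
  by apply: eq_bigr => i _ /=; ring.
apply: has_mean_sum => j _; apply: has_mean_sum => i _; apply: has_meanZ.
exact: projT2 (h i j).
Qed.

Context (G H : set (set T)) (u : T -> 'rV[R]_n) (xi : T -> R).
Hypotheses (GI : setI_closed G) (GT : G setT) (Gm : G `<=` measurable).
Hypotheses (HI : setI_closed H) (HT : H setT) (Hm : H `<=` measurable).
Hypothesis GH : indep_systems P G H.
Hypothesis Hu : @random_vector R _ (g_sigma_algebraType H) n u.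
Hypothesis Hxi : measurable_fun (setT : set (g_sigma_algebraType H)) xi.
Hypothesis u1 : {ae P, forall w, dotv (u w) (u w) = 1}.
Hypothesis u2 : forall i j,
  has_mean P (fun w => u w 0 i * u w 0 j) ((i == j)%:R / n%:R).
Hypothesis xiu : forall i, has_mean P (fun w => xi w * u w 0 i) 0.
Variable s : R.
Hypothesis xi2 : has_mean P (fun w => xi w ^+ 2) s.

Lemma random_vector_sub a :
  @random_vector R _ (g_sigma_algebraType G) n a -> random_vector a.
Proof. by move=> ra i; exact: measurable_sub_system Gm (ra i). Qed.

(** Expanded in coordinates, each term pairs the past factor [a_i b_j] with the present factor
    [u_i u_j]. Since [E u_i u_j] is [1/n] on the diagonal and 0 off it, only the trace, the mean of
    [<a, b>], survives. *)
Lemma has_mean_bilinear a b ma mb m :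
  @random_vector R _ (g_sigma_algebraType G) n a ->
  @random_vector R _ (g_sigma_algebraType G) n b ->
  has_mean P (fun w => dotv (a w) (a w)) ma ->
  has_mean P (fun w => dotv (b w) (b w)) mb ->
  has_mean P (fun w => dotv (a w) (b w)) m ->
  has_mean P (fun w => dotv (a w) (u w) * dotv (b w) (u w)) (m / n%:R).
Proof.
move=> Ga Gb ha hb hab.
have ra := random_vector_sub Ga; have rb := random_vector_sub Gb.
have h i j := cid (has_mean_coordM i j ra rb ha hb).
have -> : m = \sum_i projT1 (h i i).
  apply: has_mean_unique hab _; apply: has_mean_sum => i _.
  exact: projT2 (h i i).
have -> : (\sum_i projT1 (h i i)) / n%:R =
    \sum_i \sum_j projT1 (h i j) * ((i == j)%:R / n%:R).
  rewrite big_distrl; apply: eq_bigr => i _.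
  rewrite (bigD1 i)//= eqxx mul1r big1 ?addr0// => j ji.
  by rewrite eq_sym (negbTE ji) mul0r mulr0.
have -> : (fun w => dotv (a w) (u w) * dotv (b w) (u w)) =
    (fun w => \sum_i \sum_j (a w 0 i * b w 0 j) * (u w 0 i * u w 0 j)).
  apply/funext => w; rewrite /dotv big_distrl; apply: eq_bigr => i _.
  by rewrite big_distrr; apply: eq_bigr => j _; rewrite /= mulrACA.
apply: has_mean_sum => i _; apply: has_mean_sum => j _.
apply: (has_mean_sigma_indepM GI GT Gm HI HT Hm GH) => //.
- exact: measurable_funM (Ga i) (Gb j).
- exact: measurable_funM (Hu i) (Hu j).
- exact: projT2 (h i j).
Qed.

(** These are the cross terms between noise and error: each coordinate of the past multiplies a
    present factor [xi * u_i] of mean 0. *)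
Lemma has_mean_noise_linear a ma :
  @random_vector R _ (g_sigma_algebraType G) n a ->
  has_mean P (fun w => dotv (a w) (a w)) ma ->
  has_mean P (fun w => xi w * dotv (a w) (u w)) 0.
Proof.
move=> Ga ha; have ra := random_vector_sub Ga.
have h i := cid (has_mean_coord i ra ha).
have -> : (fun w => xi w * dotv (a w) (u w)) =
    (fun w => \sum_i a w 0 i * (xi w * u w 0 i)).
  apply/funext => w; rewrite /dotv big_distrr; apply: eq_bigr => i _ /=.
  by rewrite mulrCA.
apply: (@has_mean_eq _ _ _ _ _ (\sum_i projT1 (h i) * 0)); last first.
  by rewrite big1// => i _; rewrite mulr0.
apply: has_mean_sum => i _.
exact: (has_mean_sigma_indepM GI GT Gm HI HT Hm GH (Ga i)
  (measurable_funM Hxi (Hu i)) (projT2 (h i)) (xiu i)).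
Qed.

(** The abstract form of one iteration, used with [c1 = mu n] and [c2 = mu n / delta]. In the
    expanded square the two terms linear in the noise have mean 0. *)
Lemma has_mean_step e r (M : 'M[R]_n) (c1 c2 : R) :
  @random_vector R _ (g_sigma_algebraType G) n e ->
  has_mean P (fun w => dotv (e w) (e w)) r ->
  exists a h : R,
  [/\ has_mean P (fun w => dotv (e w *m M) (e w)) a,
      has_mean P (fun w => dotv (e w *m M) (e w *m M)) h &
      has_mean P
        (fun w => let e' := e w - (c1 * dotv (e w *m M) (u w) + c2 * xi w) *: u w in
                  dotv e' e')
        (r - 2 * c1 * (a / n%:R) + c1 ^+ 2 * (h / n%:R) + c2 ^+ 2 * s)].
Proof.
move=> Ge he; have re := random_vector_sub Ge.
have GM : @random_vector R _ (g_sigma_algebraType G) n (fun w => e w *m M).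
  exact: random_vector_mulmx.
have rM := random_vector_sub GM.
have [h hh] := has_mean_mulmx M re he.
have [a ha] := has_mean_dotv rM re hh he.
exists a, h; split=> //.
have ru : random_vector u by move=> i; exact: measurable_sub_system Hm (Hu i).
have mxi : measurable_fun setT xi by exact: measurable_sub_system Hm Hxi.
have t1 := has_mean_bilinear GM Ge hh he ha.
have t2 := has_mean_bilinear GM GM hh hh hh.
have t3 := has_mean_noise_linear Ge he.
have t4 := has_mean_noise_linear GM hh.
have tot := has_meanD (has_meanD (has_meanD he (has_meanZ (- (2 * c1)) t1))
  (has_meanD (has_meanZ (c1 ^+ 2) t2) (has_meanZ (c2 ^+ 2) xi2)))
  (has_meanD (has_meanZ (- (2 * c2)) t3) (has_meanZ (2 * c1 * c2) t4)).
apply: (@has_mean_eq _ _ _ _ _ (r + - (2 * c1) * (a / n%:R) +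
  (c1 ^+ 2 * (h / n%:R) + c2 ^+ 2 * s) +
  (- (2 * c2) * 0 + 2 * c1 * c2 * 0))); last by ring.
(* The expansion uses [|u| = 1], so it holds only almost everywhere; measurability of the left side
   is therefore proved separately. *)
apply: has_mean_ae tot.
  apply: measurable_dotv; apply: random_vectorD => //; apply: random_vectorN;
  apply: random_vectorZ => //; apply: measurable_funD; apply: measurable_funM => //;
  exact: measurable_dotv.
apply: filterS u1 => w uw1 /=.
rewrite !dotvE uw1 (dotvC (u w) (e w)).
by rewrite !mulr1; ring.
Qed.

End Step.

(** * Quadratic functions and their complex extension *)

Section Quadratic.
Context {R : realType} {n : nat}.
Implicit Types (A M : 'M[R]_n) (b x y v w : 'rV[R]_n).

Definition hess A : 'M[R]_n := 2^-1 *: (A + A^T).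

Lemma hess_sym A : (hess A)^T = hess A.
Proof. by rewrite /hess linearZ linearD /= trmxK addrC. Qed.

Lemma dotv_hess A x y :
  dotv (x *m hess A) y = (dotv (x *m A) y + dotv (y *m A) x) / 2.
Proof.
rewrite /hess -scalemxAr mulmxDr dotvZl dotvDl mulrC; congr (_ * _).
have -> : dotv (x *m A^T) y = dotv (y *m A) x by rewrite dotv_mulmxl trmxK dotvC.
by [].
Qed.

Lemma quadE A b c x : quad A b c x = dotv (x *m hess A) x / 2 + dotv b x + c.
Proof. by rewrite /quad -dotv_mx dotv_hess; lra. Qed.

(** The exact Taylor expansion; derivative, curvature bounds and the optimality condition are all
    read off from it. *)
Lemma quadD A b c x v : quad A b c (x + v) =
  quad A b c x + dotv (x *m hess A + b) v + dotv (v *m hess A) v / 2.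
Proof.
have e : dotv (v *m hess A) x = dotv (x *m hess A) v.
  by rewrite !dotv_hess addrC.
rewrite !quadE mulmxDl !dotvE e; lra.
Qed.

Lemma derive_quad A b c x v :
  derive (quad A b c) x v = dotv (x *m hess A + b) v.
Proof.
set g := dotv _ v; pose q := dotv (v *m hess A) v / 2.
have lin : (fun h : R => g + h * q) @ 0^' --> g.
  have : (fun h : R => g + h * q) @ (0 : R) --> g + 0 * q.
    by apply: cvgD; [exact: cvg_cst|apply: cvgM; [exact: cvg_id|exact: cvg_cst]].
  by rewrite mul0r addr0; apply: cvg_trans; apply: cvg_fmap2; exact: cvg_within.
rewrite /derive; apply: cvg_lim => //; apply: cvg_trans lin.
apply: near_eq_cvg; near=> h.
have h0 : h != 0 by near: h; exact: nbhs_dnbhs_neq.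
have qE : quad A b c (h *: v + x) = quad A b c x + h * g + h ^+ 2 * q.
  by rewrite [h *: v + x]addrC quadD -scalemxAl dotvZl !dotvZr -/g /q; field.
by rewrite /= qE /GRing.scale /=; field.
Unshelve. all: by end_near.
Qed.

Lemma grad_quad A b c x : grad (quad A b c) x = x *m hess A + b.
Proof.
apply/rowP => i; rewrite mxE derive_quad /dotv (bigD1 i)//= big1 ?addr0.
  by rewrite [delta_mx _ _ _ _]mxE !eqxx mulr1.
by move=> j ji; rewrite [delta_mx _ _ _ _]mxE (negbTE ji) mulr0.
Qed.

Local Notation rc := (real_complex R).

(** The imaginary part collects the terms odd in [t], and in a quadratic the linear one is the only
    such term. Hence the complex step has no bias, whatever the size of [delta]. *)
Lemma Im_quadC A b c x w (t : R) :
  complex.Im (quadC A b c (cvec x + ('i%C * (t%:C)%C) *: cvec w)) =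
  t * dotv (x *m hess A + b) w.
Proof.
have E y z : (cvec y *m map_mx rc A *m (cvec z)^T) 0 0 = rc (dotv (y *m A) z).
  by rewrite dotv_mx /cvec map_trmx -!map_mxM mxE.
have B y : \sum_i rc (b 0 i) * cvec y 0 i = rc (dotv b y).
  rewrite /dotv rmorph_sum; apply: eq_bigr => i _.
  by rewrite rmorphM /cvec mxE.
pose p := (dotv (x *m A) x - t ^+ 2 * dotv (w *m A) w) / 2 + dotv b x + c.
pose q := t * ((dotv (x *m A) w + dotv (w *m A) x) / 2 + dotv b w).
suff -> : quadC A b c (cvec x + ('i%C * rc t) *: cvec w) = rc p + 'i%C * rc q.
  by rewrite dotvDl dotv_hess -/q; move=> /=; simpc; rewrite /q.
rewrite /quadC linearD linearZ /= !mulmxDl !mulmxDr.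
rewrite -!scalemxAl -!scalemxAr.
have EZ (k : R[i]) (z : 'M[R[i]]_1) : (k *: z) 0 0 = k * z 0 0 by rewrite mxE.
have ED (z z' : 'M[R[i]]_1) : (z + z') 0 0 = z 0 0 + z' 0 0 by rewrite mxE.
rewrite !(ED, EZ) !E.
have -> : \sum_i rc (b 0 i) * (cvec x + ('i%C * rc t) *: cvec w) 0 i =
   rc (dotv b x) + 'i%C * rc t * rc (dotv b w).
  rewrite -!B big_distrr -big_split; apply: eq_bigr => i _ /=.
  by rewrite !mxE; ring.
have i2 : 'i%C * 'i%C = -1 :> R[i] by rewrite -expr2 sqr_i.
have -> (T S : R[i]) : 'i%C * T * ('i%C * T * S) = - (T ^+ 2 * S).
  by rewrite mulrA mulrACA i2 expr2; ring.
rewrite /p /q !(rmorphD, rmorphB, rmorphM, rmorphXn, fmorphV, rmorph_nat).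
by ring.
Qed.

Lemma quad_segment_open (D : set 'rV[R]_n) x v :
  open (D : set (_ : normedModType R)) -> D x ->
  exists2 e : R, 0 < e & forall t, `|t| < e -> D (x + t *: v).
Proof.
move=> oD Dx.
have cv : (fun t : R => x + t *: v) @ (0 : R) --> x + 0 *: v.
  by apply: cvgD; [exact: cvg_cst|apply: cvgZ; [exact: cvg_id|exact: cvg_cst]].
rewrite scale0r addr0 in cv.
have /cv /nbhs_ballP[e /= e0 h] : nbhs x D by exact: open_nbhs_nbhs.
exists e => // t te; apply: h => /=.
by rewrite /ball /= sub0r normrN.
Qed.

Section OnOpenDomain.
Variables (A : 'M[R]_n) (b : 'rV[R]_n) (c : R) (D : set 'rV[R]_n).
Variables (xs : 'rV[R]_n) (tau L1 : R).
Hypotheses (oD : open (D : set (_ : normedModType R))) (Dxs : D xs).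
Let f := quad A b c.

(** At [xs] and [xs + t v] the constant and linear terms cancel; what is left is homogeneous of
    degree 2 in [t], so a small [t] keeping the point in [D] can be divided out. *)
Lemma quad_strong_convex :
  (forall x y, D x -> D y ->
     f x + dotv (grad f x) (y - x) + tau / 2 * norm2 (y - x) ^+ 2 <= f y) ->
  forall v, tau * dotv v v <= dotv (v *m hess A) v.
Proof.
move=> sc v; have [e e0 he] := quad_segment_open v oD Dxs.
have te : `|e / 2| < e by rewrite ger0_norm; lra.
have := sc _ _ Dxs (he _ te).
rewrite grad_quad norm2_sqr /f quadD (addrAC xs) subrr add0r -scalemxAl.
rewrite !(dotvZl, dotvZr).
have : 0 < (e / 2) ^+ 2 by rewrite exprn_gt0//; lra.
set t := e / 2; move=> t0 h.
rewrite -(ler_pM2l t0); lra.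
Qed.

Lemma quad_lipschitz : 0 < L1 ->
  (forall x y, D x -> D y ->
     norm2 (grad f x - grad f y) <= L1 * norm2 (x - y)) ->
  forall v, dotv (v *m hess A) (v *m hess A) <= L1 ^+ 2 * dotv v v.
Proof.
move=> L0 lip v; have [e e0 he] := quad_segment_open v oD Dxs.
have te : `|e / 2| < e by rewrite ger0_norm; lra.
have := lip _ _ (he _ te) Dxs.
set t := e / 2 in te *.
have -> : grad f (xs + t *: v) - grad f xs = t *: (v *m hess A).
  by rewrite !grad_quad mulmxDl -scalemxAl opprD addrACA subrr addr0 addrAC subrr add0r.
rewrite addrAC subrr add0r.
move=> h; have : norm2 (t *: (v *m hess A)) ^+ 2 <= (L1 * norm2 (t *: v)) ^+ 2.
  by rewrite lerXn2r// nnegrE ?mulr_ge0 ?sqrtr_ge0// ltW.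
rewrite exprMn !norm2_sqr !dotvE.
have t0 : 0 < t ^+ 2 by rewrite exprn_gt0// /t; lra.
by move=> h2; rewrite -(ler_pM2l t0); lra.
Qed.

Lemma quad_min_grad0 : (forall x, D x -> f xs <= f x) -> xs *m hess A + b = 0.
Proof.
move=> mn; have [g gE] : exists g, g = xs *m hess A + b by eexists.
rewrite -gE; pose q := dotv (g *m hess A) g.
have [e e0 he] := quad_segment_open g oD Dxs.
have key t : `|t| < e -> 0 <= t * dotv g g + t ^+ 2 * q / 2.
  move=> te; have := mn _ (he _ te); rewrite /f quadD -gE -scalemxAl !(dotvZl, dotvZr) -/q.
  by lra.
suff g0 : dotv g g <= 0.
  apply/rowP => i; rewrite mxE; apply/eqP; rewrite -sqrf_eq0 eq_le sqr_ge0 andbT.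
  exact: le_trans (coord_sqr_le g i) g0.
rewrite leNgt; apply/negP => gg.
(* A step [- t g] along the negative gradient: [t <= e / 2] stays in [D], and [t |q| <= |g|^2] keeps
   the quadratic term below half of the linear decrease, contradicting minimality. *)
pose t := Num.min (e / 2) (dotv g g / (`|q| + 1)).
have q1 : 0 < `|q| + 1 by rewrite ltr_wpDl.
have t0 : 0 < t by rewrite lt_min !divr_gt0//.
have t1 : t <= e / 2 by rewrite ge_min lexx.
have t2 : t * (`|q| + 1) <= dotv g g by rewrite -ler_pdivlMr// ge_min lexx orbT.
have := key (- t); rewrite normrN gtr0_norm// => /(_ _); rewrite sqrrN.
have te : t < e by lra.
move=> /(_ te) h.
have qa := ler_norm q.
have : t * (t * q) <= t * (dotv g g).
  by rewrite ler_pM2l//; nra.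
have : 0 < t * dotv g g by exact: mulr_gt0.
by nra.
Qed.

End OnOpenDomain.

(** For a unit vector [v], expanding [|v H - L1 v|^2 >= 0] gives [<v H, v> <= L1]. The result forces
    [n L1^2 / tau^2 >= 1], and so [K0 > 0]. *)
Lemma hess_bounds_le A (tau L1 : R) : (0 < n)%N -> 0 < L1 ->
  (forall v, tau * dotv v v <= dotv (v *m hess A) v) ->
  (forall v, dotv (v *m hess A) (v *m hess A) <= L1 ^+ 2 * dotv v v) ->
  tau <= L1.
Proof.
move=> n0 L0 sc lip.
pose v : 'rV[R]_n := delta_mx 0 (Ordinal n0).
have v1 : dotv v v = 1.
  rewrite /dotv (bigD1 (Ordinal n0))//= big1 ?addr0 ?mxE ?eqxx ?mulr1// => j ji.
  by rewrite mxE (negbTE ji) mulr0.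
have := dotv_ge0 (v *m hess A - L1 *: v); rewrite !dotvE v1 (dotvC v).
have := sc v; have := lip v; rewrite v1.
set p := dotv _ _; set q := dotv _ v => h1 h2 h3.
by nra.
Qed.

Lemma dotv_sumr (I : Type) (s : seq I) (v : 'rV[R]_n) (F : I -> 'rV[R]_n) :
  dotv v (\sum_(k <- s) F k) = \sum_(k <- s) dotv v (F k).
Proof.
elim: s => [|k s ih]; last by rewrite !big_cons dotvDr ih.
by rewrite !big_nil /dotv big1// => i _; rewrite mxE mulr0.
Qed.

(** The form summed over the deviations [F k - m] is nonnegative; expanding it, the cross terms
    combine through the definition of the average [m]. *)
Lemma quadratic_form_jensen M (I : Type) (s : seq I) (F : I -> 'rV[R]_n) m :
  M^T = M -> (forall v, 0 <= dotv (v *m M) v) ->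
  (size s)%:R *: m = \sum_(k <- s) F k ->
  (size s)%:R * dotv (m *m M) m <= \sum_(k <- s) dotv (F k *m M) (F k).
Proof.
move=> sM pM; set N := (size s)%:R => Nm.
have sw x y : dotv (x *m M) y = dotv (y *m M) x by rewrite dotv_mulmxl sM dotvC.
have : 0 <= \sum_(k <- s) dotv ((F k - m) *m M) (F k - m).
  by apply: sumr_ge0 => k _.
have -> : \sum_(k <- s) dotv ((F k - m) *m M) (F k - m) =
    \sum_(k <- s) (dotv (F k *m M) (F k) - 2 * dotv (m *m M) (F k) +
      dotv (m *m M) m).
  by apply: eq_bigr => k _; rewrite mulmxBl !dotvE (sw (F k) m); ring.
rewrite !big_split /= sumrN -big_distrr /= -dotv_sumr -Nm dotvZr.
rewrite big_const_seq count_predT iter_addr addr0 -[_ *+ _]mulr_natl -/N; lra.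
Qed.

End Quadratic.

(** * The scalar recursion *)

Section Recursion.
Context {R : realType}.

(** From [ln (1 + x) <= x] at [x = - 1 / (k + 1)]; it makes the harmonic sum of the noise
    telescope. *)
Lemma inv_le_ln_diff k : (0 < k)%N ->
  (k.+1%:R : R)^-1 <= ln k.+1%:R - ln k%:R.
Proof.
move=> k0; have K0 : 0 < k%:R :> R by rewrite ltr0n.
have K1 : 0 < k.+1%:R :> R by rewrite ltr0n.
have x1 : -1 < - (k.+1%:R : R)^-1.
  by rewrite ltrN2 invf_lt1// ltr1n.
have := le_ln1Dx x1.
have -> : 1 - (k.+1%:R : R)^-1 = k%:R / k.+1%:R.
  have -> : k%:R = k.+1%:R - 1 :> R by rewrite -natr1 addrK.
  by field; rewrite gt_eqF.
by rewrite ln_div ?posrE// lerNr opprB.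
Qed.

Variables (tau S m : R) (r a mu : nat -> R) (K K0 : nat).
Hypotheses (tau0 : 0 < tau) (S0 : 0 <= S) (m0 : 0 <= m).
Hypotheses (K01 : (0 < K0)%N) (K0K : (2 * K0 <= K)%N).
Hypothesis m4 : 4 * m < K0.+1%:R.
Hypothesis mu_early : forall k, (k <= K0)%N -> mu k = (tau * K%:R)^-1.
Hypothesis mu_late : forall k, (K0 < k)%N -> mu k = 2 / (tau * k%:R).
Hypothesis r0 : forall k, (1 <= k <= K.+1)%N -> 0 <= r k.
Hypothesis ra : forall k, (1 <= k <= K)%N -> tau * r k <= a k.
Hypothesis step : forall k, (1 <= k <= K)%N ->
  r k.+1 <= r k - 2 * mu k * a k + mu k ^+ 2 * (tau ^+ 2 * (m * r k + S)).

(** The descent term is at least [2 r / K], while the multiplicative noise [m r / K^2] is at most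
    [r / K] because [m <= K]. Only the additive noise [S / K^2] accumulates. *)
Lemma early_phase j : (j <= K0)%N ->
  r j.+1 <= r 1%N + j%:R * (S / K%:R ^+ 2).
Proof.
have KN0 : (0 < K)%N by lia.
have X0 : 0 < K%:R :> R by rewrite ltr0n.
have mK : m <= K%:R.
  have : K0.+1%:R <= K%:R :> R by rewrite ler_nat; lia.
  by have m4' := m4; move=> ?; lra.
elim: j => [_|j ih jK]; first by rewrite mul0r addr0.
have kK : (1 <= j.+1 <= K)%N by lia.
have := step kK; have := ra kK; have := ih (ltnW jK).
have rk0 : 0 <= r j.+1 by apply: r0; lia.
rewrite mu_early//.
set X : R := K%:R; pose y := a j.+1 / tau.
have -> : a j.+1 = tau * y by rewrite /y mulrC divfK ?gt_eqF.
rewrite ler_pM2l// => h1 h2.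
have -> : r j.+1 - 2 * (tau * X)^-1 * (tau * y) +
    (tau * X)^-1 ^+ 2 * (tau ^+ 2 * (m * r j.+1 + S)) =
    r j.+1 - (2 * y - (m / X) * r j.+1) / X + S / X ^+ 2.
  by field; rewrite !gt_eqF.
have : m / X <= 1 by rewrite ler_pdivrMr ?mul1r.
move=> mX h3; apply: (le_trans h3).
have : 0 <= (2 * y - m / X * r j.+1) / X.
  by apply: divr_ge0; [nra|exact: ltW].
have -> : j.+1%:R * (S / X ^+ 2) = j%:R * (S / X ^+ 2) + S / X ^+ 2.
  by rewrite -(natr1 j) mulrDl mul1r.
by lra.
Qed.

(** Multiplying step [k] by [k] gives the descent term [4 a_k / tau]. Half of it is at least
    [2 r_k]: one [r_k] lowers the weight from [k] to [k - 1], the other absorbs [(4 m / k) r_k]. The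
    remaining half is kept and forms the sum. *)
Lemma late_phase j : (K0 + j <= K)%N ->
  (K0 + j)%:R * r (K0 + j).+1 + 2 / tau * \sum_(K0.+1 <= k < (K0 + j).+1) a k
  <= K0%:R * r K0.+1 + 4 * S * (ln (K0 + j)%:R - ln K0%:R).
Proof.
elim: j => [_|j ih jK].
  by rewrite addn0 big_geq// subrr !mulr0 !addr0.
rewrite addnS in jK *; set k := (K0 + j)%N in ih jK *.
have kK : (1 <= k.+1 <= K)%N by lia.
rewrite big_nat_recr /=; last by rewrite /k; lia.
have := step kK; have := ra kK; have := ih (ltnW jK).
have rk0 : 0 <= r k.+1 by apply: r0; lia.
rewrite mu_late; last by rewrite /k; lia.
have lnk : (k.+1%:R : R)^-1 <= ln k.+1%:R - ln k%:R.
  by apply: inv_le_ln_diff; rewrite /k; lia.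
have mX : 4 * m <= k.+1%:R.
  have : K0.+1%:R <= k.+1%:R :> R by rewrite ler_nat /k; lia.
  by have m4' := m4; move=> ?; lra.
have kX : k%:R = k.+1%:R - 1 :> R by rewrite -natr1 addrK.
have X0 : 0 < k.+1%:R :> R by rewrite ltr0n.
move: lnk mX kX X0; set X : R := k.+1%:R => lnk mX kX X0.
set s := \sum_(_ <= _ < _) _.
pose y := a k.+1 / tau.
have ay : a k.+1 = tau * y by rewrite /y mulrC divfK ?gt_eqF.
rewrite !ay ler_pM2l// => h1 h2 h3.
have h4 : X * r k.+2 <= X * r k.+1 - 4 * y + (4 * m / X) * r k.+1 + 4 * S * X^-1.
  have -> : X * r k.+1 - 4 * y + (4 * m / X) * r k.+1 + 4 * S * X^-1 =
    X * (r k.+1 - 2 * (2 / (tau * X)) * (tau * y) +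
      (2 / (tau * X)) ^+ 2 * (tau ^+ 2 * (m * r k.+1 + S))).
    by field; rewrite !gt_eqF.
  by rewrite ler_pM2l.
have h5 : 4 * m / X <= 1 by rewrite ler_pdivrMr ?mul1r.
have h6 : 4 * m / X * r k.+1 <= r k.+1.
  by rewrite -[leRHS]mul1r; exact: ler_wpM2r.
have h7 : 4 * S * X^-1 <= 4 * S * (ln X - ln k%:R).
  by apply: ler_wpM2l => //; rewrite mulr_ge0.
have h8 : 2 / tau * (s + tau * y) = 2 / tau * s + 2 * y.
  by field; rewrite gt_eqF.
have kr : k%:R * r k.+1 = X * r k.+1 - r k.+1 by rewrite kX mulrBl mul1r.
rewrite h8; rewrite kr in h1.
have h9 : 4 * S * (ln X - ln K0%:R) =
  4 * S * (ln X - ln k%:R) + 4 * S * (ln k%:R - ln K0%:R) by ring.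
rewrite h9; move: h1 h4 h6 h7 h2.
move: (4 * S * (ln k%:R - _)) (4 * S * (ln X - _)) (4 * m / X * _) => p1 p2 p3.
by move: (2 / tau * s) (X * r k.+1) (X * r k.+2) (K0%:R * _) (4 * S * X^-1)
  => *; lra.
Qed.

(** The final error and [ln K0] are dropped by sign. The early phase contributes [K0 S / K^2], at
    most [S / (2 K)] because [K0 <= K / 2]. *)
Lemma recursion_sum_le :
  \sum_(K0.+1 <= k < K.+1) a k <=
  tau / 2 * (K0%:R * (r 1%N + S / (2 * K%:R)) + 4 * S * ln K%:R).
Proof.
have KE : (K0 + (K - K0))%N = K by lia.
have := @late_phase (K - K0); rewrite KE => /(_ (leqnn _)).
have X0 : 0 < K%:R :> R by rewrite ltr0n; lia.
have K0R : 0 <= K0%:R :> R by [].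
have rK : 0 <= K%:R * r K.+1 by rewrite mulr_ge0// r0// leqnn.
have l0 : 0 <= ln K0%:R :> R by rewrite ln_ge0// ler1n.
have h1 : r K0.+1 <= r 1%N + S / (2 * K%:R).
  apply: (le_trans (early_phase (leqnn _))); rewrite lerD2l.
  have -> : S / (2 * K%:R) = (K%:R / 2) * (S / K%:R ^+ 2).
    by field; rewrite gt_eqF.
  apply: ler_wpM2r; first by rewrite divr_ge0// exprn_ge0.
  by rewrite ler_pdivlMr// -natrM ler_nat; lia.
have h2 : K0%:R * r K0.+1 <= K0%:R * (r 1%N + S / (2 * K%:R)).
  exact: ler_wpM2l.
have h3 : 0 <= 4 * S * ln K0%:R by rewrite !mulr_ge0.
set s := \sum_(_ <= _ < _) _ => h.
have -> : s = tau / 2 * (2 / tau * s) by field; rewrite gt_eqF.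
by apply: ler_wpM2l; [rewrite divr_ge0// ltW|lra].
Qed.

End Recursion.

(** * Convergence of the averaged iterate *)

Section Descent.
Context {R : realType} {d} {T : measurableType d} (P : probability T R).
Context {n : nat} (A : 'M[R]_n) (b : 'rV[R]_n) (c : R).
Variables (tau L1 delta sigma : R) (xs x1 : 'rV[R]_n) (K : nat).
Variables (u : nat -> T -> 'rV[R]_n) (xi : nat -> T -> R) (mu : nat -> R).

Let M := hess A.
Let x k w := cs_iter (quadC A b c) x1 mu (fun=> delta) (u^~ w) (xi^~ w) k.
Let e k w := x k w - xs.

Hypothesis n_gt0 : (0 < n)%N.
Hypothesis delta_gt0 : 0 < delta.
Hypothesis grad0 : xs *m hess A + b = 0.
Hypothesis lip : forall v,
  dotv (v *m hess A) (v *m hess A) <= L1 ^+ 2 * dotv v v.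
Hypothesis uu : forall k, (1 <= k <= K)%N -> uniform_on_sphere P (u k).
Hypothesis hxi : forall k, (1 <= k <= K)%N ->
  measurable_fun setT (xi k) /\
  P.-integrable setT (fun w => (xi k w)%:E) /\
  (\int[P]_w (xi k w)%:E = 0)%E /\
  (\int[P]_w ((xi k w) ^+ 2)%:E <= sigma%:E)%E.
Hypothesis ind : mutually_independent P K u xi.

(** As the gradient vanishes at [xs], the gradient at [x k] is the error times the Hessian, so the
    errors obey a closed recursion. *)
Lemma iter_error_step k w : (0 < k)%N ->
  e k.+1 w = e k w - (mu k * n%:R * dotv (e k w *m M) (u k w)
                      + mu k * n%:R / delta * xi k w) *: u k w.
Proof.
case: k => // k _; rewrite /e /x.
set y := cs_iter _ _ _ _ _ _ k.+1.
have -> : cs_iter (quadC A b c) x1 mu (fun=> delta) (u^~ w) (xi^~ w) k.+2 =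
  y - mu k.+1 *: cs_grad_est (quadC A b c) delta (u k.+1 w) (xi k.+1 w) y by [].
have gE : y *m hess A + b = (y - xs) *m M.
  by rewrite mulmxBl -[LHS]subr0 -grad0 opprD addrACA subrr addr0.
rewrite /cs_grad_est Im_quadC gE -scalerDl scalerA addrAC; congr (_ - _ *: _).
by field; rewrite gt_eqF.
Qed.

(* The rounds whose randomness enters the [k]-th iterate. *)
Definition past (k : nat) : pred nat := [pred j | (1 <= j < k)%N].

(** Adaptedness: it places the error of round [k] on the past side of the independence between
    rounds. *)
Lemma iter_error_past k : (1 <= k)%N ->
  @random_vector R _ (g_sigma_algebraType (boxes u xi (past k))) n (e k).
Proof.
elim: k => // -[_ _|k ih _]; first exact: (@random_vector_cst R _ (g_sigma_algebraType _) n (x1 - xs)).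
have ih' := ih isT.
have sub : {subset past k.+1 <= past k.+2}.
  by move=> j; rewrite !inE => /andP[-> /ltnW].
have kin : past k.+2 k.+1 by rewrite /past /= leqnn.
have -> : e k.+2 = fun w => e k.+1 w -
    (mu k.+1 * n%:R * dotv (e k.+1 w *m M) (u k.+1 w)
     + mu k.+1 * n%:R / delta * xi k.+1 w) *: u k.+1 w.
  by apply/funext => w; rewrite iter_error_step.
have re : @random_vector R _ (g_sigma_algebraType (boxes u xi (past k.+2))) n (e k.+1).
  by move=> i; exact: measurable_boxesS sub (ih' i).
have ru : @random_vector R _ (g_sigma_algebraType (boxes u xi (past k.+2))) n (u k.+1).
  exact: random_vector_boxes kin.
apply: random_vectorD => //; apply: random_vectorN.
apply: random_vectorZ => //; apply: measurable_funD; apply: measurable_funM => //.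
  by apply: measurable_dotv => //; exact: random_vector_mulmx.
exact: measurable_noise_boxes.
Qed.

Lemma direction_random k : (1 <= k <= K)%N -> random_vector (u k).
Proof. by move=> /uu; exact: uniform_random_vector. Qed.

Lemma noise_measurable k : (1 <= k <= K)%N -> measurable_fun setT (xi k).
Proof. by move=> /hxi[]. Qed.

(** Direction and noise of one round are independent and [E xi = 0]; a coordinate of [u] has a mean
    because [|u| = 1] almost everywhere. *)
Lemma noise_direction_mean k i : (1 <= k <= K)%N ->
  has_mean P (fun w => xi k w * u k w 0 i) 0.
Proof.
move=> kK; have [mxi [ixi [xi0 _]]] := hxi kK.
have ru := direction_random kK.
have h1 : has_mean P (fun w => dotv (u k w) (u k w)) 1.
  apply: has_mean_ae (has_mean_cst P 1); first exact: measurable_dotv.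
  by apply: filterS (uniform_dotv1 (uu kK)) => w ->.
have [m hm] := has_mean_coord i ru h1.
have hx : has_mean P (xi k) 0 by split.
rewrite -(mul0r m); apply: has_mean_indepM => // B C mB mC.
rewrite setIC muleC.
exact: (direction_noise_indep ind kK
  (@measurable_coord_rV R n i)).
Qed.

Lemma noise_variance k : (1 <= k <= K)%N ->
  exists2 s, has_mean P (fun w => xi k w ^+ 2) s & s <= sigma.
Proof.
move=> kK; have [mxi [ixi [_ xi2]]] := hxi kK.
have i2 : P.-integrable setT (EFin \o (fun w => xi k w ^+ 2)).
  apply/integrableP; split; first exact/measurable_EFinP/measurable_funX.
  under eq_integral => w _ do rewrite /= ger0_norm ?sqr_ge0//.
  by apply: le_lt_trans xi2 _; rewrite ltry.
exists (fine (\int[P]_w (xi k w ^+ 2)%:E)); first exact: integrable_has_mean.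
by rewrite -lee_fin fineK//; exact: integrable_fin_num.
Qed.

(** Total through [fine], which lets [r] and [a] be named before integrability is known;
    [has_mean_mean] recovers the true value afterwards. *)
Definition mean (X : T -> R) : R := fine (\int[P]_w (X w)%:E).

Lemma has_mean_mean X m : has_mean P X m -> mean X = m.
Proof. by rewrite /mean => -[_ ->]. Qed.

Let r k := mean (fun w => dotv (e k w) (e k w)).
Let a k := mean (fun w => dotv (e k w *m M) (e k w)).

(** Integrability at [k] is a premise and integrability at [k.+1] a conclusion, so that finiteness
    of the moments propagates by induction together with the recursion. *)
Lemma iter_error_moments k : (1 <= k <= K)%N ->
  has_mean P (fun w => dotv (e k w) (e k w)) (r k) ->
  [/\ has_mean P (fun w => dotv (e k w *m M) (e k w)) (a k),
      has_mean P (fun w => dotv (e k.+1 w) (e k.+1 w)) (r k.+1) &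
      r k.+1 <= r k - 2 * mu k * a k +
        mu k ^+ 2 * (n%:R * L1 ^+ 2 * r k + n%:R ^+ 2 * sigma / delta ^+ 2)].
Proof.
move=> kK hr; have k0 : (0 < k)%N by case/andP: kK.
have pK j : past k j -> (1 <= j <= K)%N by rewrite /past /=; lia.
have kK' j : pred1 k j -> (1 <= j <= K)%N by move=> /eqP ->.
have dis j : past k j -> pred1 k j -> false.
  by move=> + /eqP jk; rewrite jk /past /= ltnn andbF.
have [s hs sle] := noise_variance kK.
have kk : pred1 k k by rewrite /= eqxx.
have [a' [h [ha hh hr']]] := has_mean_step
  (@boxes_setI _ _ _ _ u xi (past k)) (@boxes_setT _ _ _ _ u xi (past k))
  (boxes_measurable direction_random noise_measurable pK)
  (@boxes_setI _ _ _ _ u xi (pred1 k)) (@boxes_setT _ _ _ _ u xi (pred1 k))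
  (boxes_measurable direction_random noise_measurable kK')
  (boxes_indep ind pK kK' dis)
  (@random_vector_boxes _ _ _ _ u xi _ _ kk)
  (@measurable_noise_boxes _ _ _ _ u xi _ _ kk)
  (uniform_dotv1 (uu kK)) (uniform_second_moment (uu kK))
  (fun i => noise_direction_mean i kK) hs M
  (mu k * n%:R) (mu k * n%:R / delta) (iter_error_past k0) hr.
have aE : a k = a' by exact: has_mean_mean ha.
have n0 : n%:R != 0 :> R by rewrite pnatr_eq0 -lt0n.
have hr2 : has_mean P (fun w => dotv (e k.+1 w) (e k.+1 w))
   (r k - 2 * mu k * a' + mu k ^+ 2 * (n%:R * h + n%:R ^+ 2 * s / delta ^+ 2)).
  under eq_fun do rewrite iter_error_step//.
  apply: has_mean_eq hr' _; field.
  by rewrite n0 gt_eqF.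
have rE := has_mean_mean hr2; rewrite -/(r k.+1) in rE.
split; [by rewrite aE|by rewrite rE|].
rewrite rE aE lerD2l; apply: ler_wpM2l; first exact: sqr_ge0.
have hle : h <= L1 ^+ 2 * r k.
  by apply: has_mean_le hh (has_meanZ (L1 ^+ 2) hr) _ => w; exact: lip.
apply: lerD; first by rewrite -mulrA ler_wpM2l.
by rewrite ler_wpM2r ?invr_ge0 ?sqr_ge0// ler_wpM2l// sqr_ge0.
Qed.

Lemma iter_error_sqr_mean k : (1 <= k <= K.+1)%N ->
  has_mean P (fun w => dotv (e k w) (e k w)) (r k).
Proof.
elim: k => // -[_ _|k ih kK].
  have h := has_mean_cst P (dotv (x1 - xs) (x1 - xs)).
  by apply: has_mean_eq (h) _; apply/esym/(has_mean_mean h).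
have kK' : (1 <= k.+1 <= K)%N by lia.
by have [] := iter_error_moments kK' (ih ltac:(lia)).
Qed.

Variable K0 : nat.
Hypothesis tau_gt0 : 0 < tau.
Hypothesis sc : forall v, tau * dotv v v <= dotv (v *m hess A) v.
Hypothesis sigma_ge0 : 0 <= sigma.
Let m := n%:R * L1 ^+ 2 / tau ^+ 2.
Hypothesis K0_le : K0%:R <= 4 * m.
Hypothesis K0_gt : 4 * m < K0.+1%:R.
Hypothesis K0_gt0 : (0 < K0)%N.
Hypothesis K0K : (2 * K0 <= K)%N.
Hypothesis mu_early : forall k, (k <= K0)%N -> mu k = (tau * K%:R)^-1.
Hypothesis mu_late : forall k, (K0 < k)%N -> mu k = 2 / (tau * k%:R).

Lemma sum_form_mean_le :
  \sum_(K0.+1 <= k < K.+1) a k <= tau / 2 *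
    (K0%:R * (dotv (x1 - xs) (x1 - xs) +
       n%:R ^+ 2 * sigma / delta ^+ 2 / tau ^+ 2 / (2 * K%:R)) +
     4 * (n%:R ^+ 2 * sigma / delta ^+ 2 / tau ^+ 2) * ln K%:R).
Proof.
have -> : dotv (x1 - xs) (x1 - xs) = r 1.
  apply/esym; exact: (has_mean_mean (has_mean_cst P (dotv (x1 - xs) (x1 - xs)))).
apply: (@recursion_sum_le _ tau _ m r a mu K K0) => //.
- apply: divr_ge0; last exact: sqr_ge0.
  apply: divr_ge0; last exact: sqr_ge0.
  by apply: mulr_ge0 => //; exact: sqr_ge0.
- apply: divr_ge0; last exact: sqr_ge0.
  by apply: mulr_ge0 => //; exact: sqr_ge0.
- move=> k kK; apply: has_mean_le (has_mean_cst P 0) (iter_error_sqr_mean kK) _.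
  by move=> w; exact: dotv_ge0.
- move=> k kK; have hr := iter_error_sqr_mean (_ : (1 <= k <= K.+1)%N).
  have kK1 : (1 <= k <= K.+1)%N by lia.
  have [ha _ _] := iter_error_moments kK (hr kK1).
  by apply: has_mean_le (has_meanZ tau (hr kK1)) ha _ => w; exact: sc.
- move=> k kK; have kK1 : (1 <= k <= K.+1)%N by lia.
  have [_ _ h] := iter_error_moments kK (iter_error_sqr_mean kK1).
  apply: (le_trans h); rewrite lerD2l; apply: ler_wpM2l; first exact: sqr_ge0.
  by rewrite /m le_eqVlt; apply/orP; left; apply/eqP; field; rewrite !gt_eqF.
Qed.

(** With zero gradient at [xs] the gap is exactly half the Hessian form of the averaged error, to
    which Jensen applies pointwise. *)
Lemma expected_gap_le :
  (\int[P]_w (quad A b c ((K - K0)%:R^-1 *: \sum_(K0.+1 <= k < K.+1) x k w)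
               - quad A b c xs)%:E <=
   ((2 * (K - K0)%:R)^-1 * \sum_(K0.+1 <= k < K.+1) a k)%:E)%E.
Proof.
pose N : R := (K - K0)%:R; pose s := index_iota K0.+1 K.+1.
pose f := quad A b c; pose xbar w := N^-1 *: \sum_(k <- s) x k w.
rewrite -/N -/s -/f; under eq_integral do rewrite -/(xbar _).
have N0 : 0 < N by rewrite ltr0n; lia.
have sz : (size s)%:R = N by rewrite size_iota subSS.
have inK k : k \in s -> (1 <= k <= K)%N by rewrite mem_index_iota; lia.
have pM v : 0 <= dotv (v *m M) v.
  by apply: le_trans (sc v); rewrite mulr_ge0 ?dotv_ge0// ltW.
have gap w : f (xbar w) - f xs = dotv ((xbar w - xs) *m M) (xbar w - xs) / 2.
  have := quadD A b c xs (xbar w - xs).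
  rewrite (addrC xs) subrK grad0 /f => ->.
  have -> v : dotv (0 : 'rV[R]_n) v = 0.
    by rewrite /dotv big1// => i _; rewrite mxE mul0r.
  by rewrite addr0 addrC addKr.
have Nbar w : N *: (xbar w - xs) = \sum_(k <- s) e k w.
  rewrite scalerBr scalerA divff ?gt_eqF// scale1r /e big_split /= -/s.
  congr (_ + _); rewrite big_const_seq count_predT iter_addr addr0.
  by rewrite -scaler_nat sz scalerN.
have hq : has_mean P (fun w => \sum_(k <- s) dotv (e k w *m M) (e k w))
    (\sum_(k <- s) a k).
  apply: has_mean_sum => k /inK kK.
  have kK1 : (1 <= k <= K.+1)%N by lia.
  by have [] := iter_error_moments kK (iter_error_sqr_mean kK1).
have [iq eq] := has_meanZ (2 * N)^-1 hq.
(* Comparison of nonnegative integrals asks only for measurability of the gap, not for its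
   integrability. *)
rewrite -eq; apply: ge0_le_integral => //.
- by move=> w _; rewrite lee_fin gap divr_ge0.
- apply/measurable_EFinP; under eq_fun do rewrite gap.
  have rb : random_vector (fun w => xbar w - xs).
    have -> : (fun w => xbar w - xs) = (fun w => N^-1 *: \sum_(k <- s) e k w).
      by apply/funext => w; rewrite -Nbar scalerA mulVf ?scale1r// gt_eqF.
    apply: random_vectorZ; first exact: measurable_cst.
    apply: random_vector_sum => k /inK kK i.
    apply: (measurable_sub_system (G := boxes u xi (past k))).
      apply: (boxes_measurable direction_random noise_measurable).
      by move=> j; rewrite /past /=; lia.
    by apply: iter_error_past; case/andP: kK.
  apply: measurable_funM => //; apply: measurable_dotv => //.
  exact: random_vector_mulmx.
- by move: iq => /measurable_int.
- move=> w _; rewrite lee_fin gap.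
  have := quadratic_form_jensen (hess_sym A) pM (F := e^~ w) (s := s)
    (m := xbar w - xs).
  rewrite sz => /(_ (Nbar w)) h.
  rewrite invfM -mulrA mulrC; apply: ler_wpM2l => //.
  by rewrite mulrC ler_pdivlMr// mulrC.
Qed.

(** Constants: [K0 <= 4 m] turns [tau / 2 * K0] into [2 tau m], whence 2; the noise bracket
    [K0 / (2 K) + 4 ln K] is at most [6 (1 + ln K)], whose half gives 3. Averaging costs nothing
    more, since [K <= 2 (K - K0)]. *)
Lemma expected_gap_rate :
  (\int[P]_w (quad A b c ((K - K0)%:R^-1 *: \sum_(K0.+1 <= k < K.+1) x k w)
               - quad A b c xs)%:E <=
   (2 * (n%:R * L1 ^+ 2 / tau) * dotv (x1 - xs) (x1 - xs) / K%:R
    + 3 * (1 + ln K%:R) * (n%:R ^+ 2 * sigma / (tau * delta ^+ 2))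
      / K%:R)%:E)%E.
Proof.
have [K_gt0 KK0_gt0 K_le] : [/\ (0 < K)%N, (0 < K - K0)%N & (K <= 2 * (K - K0))%N].
  by clear -K0_gt0 K0K; split; lia.
apply: (le_trans expected_gap_le); rewrite lee_fin.
have sm := sum_form_mean_le.
set s := \sum_(_ <= _ < _) _ in sm *; set rho := dotv _ _ in sm *.
have X0 : 0 < K%:R :> R by rewrite ltr0n.
have m_ge0 : 0 <= m.
  by apply: divr_ge0; [apply: mulr_ge0 => //; exact: sqr_ge0|exact: sqr_ge0].
have l0 : 0 <= ln K%:R :> R by rewrite ln_ge0// ler1n.
have rho0 : 0 <= rho by exact: dotv_ge0.
pose S := n%:R ^+ 2 * sigma / delta ^+ 2 / tau ^+ 2.
rewrite -/S in sm.
have S0 : 0 <= S.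
  apply: divr_ge0; last exact: sqr_ge0.
  apply: divr_ge0; last exact: sqr_ge0.
  by apply: mulr_ge0 => //; exact: sqr_ge0.
have -> : n%:R * L1 ^+ 2 / tau = tau * m by rewrite /m; field; rewrite gt_eqF.
have -> : n%:R ^+ 2 * sigma / (tau * delta ^+ 2) = tau * S.
  by rewrite /S; field; rewrite !gt_eqF.
have K0X : K0%:R <= K%:R / 2 :> R.
  by rewrite ler_pdivlMr// -natrM ler_nat mulnC.
have sm' : s <= K%:R * (2 * (tau * m) * rho / K%:R
    + 3 * (1 + ln K%:R) * (tau * S) / K%:R).
  apply: (le_trans sm).
  have -> : K%:R * (2 * (tau * m) * rho / K%:R
    + 3 * (1 + ln K%:R) * (tau * S) / K%:R) =
    tau / 2 * (4 * m * rho + 6 * (1 + ln K%:R) * S).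
    by field; rewrite gt_eqF.
  apply: ler_wpM2l; first by rewrite divr_ge0// ltW.
  have h1 : K0%:R * rho <= 4 * m * rho by exact: ler_wpM2r.
  have h2 : K0%:R * (S / (2 * K%:R)) <= S.
    rewrite mulrA ler_pdivrMr ?mulr_gt0// mulrC; apply: ler_wpM2l => //.
    by apply: (le_trans K0X); move: X0; set X : R := K%:R; lra.
  have h3 : 0 <= ln K%:R * S by exact: mulr_ge0.
  rewrite mulrDr; move: h1 h2 h3 S0 l0.
  move: (K0%:R * rho) (4 * m * rho) (K0%:R * _) => p1 p2 p3 *.
  by lra.
have N0 : 0 < (K - K0)%:R :> R by rewrite ltr0n.
rewrite mulrC ler_pdivrMr ?mulr_gt0// [leRHS]mulrC.
apply: (le_trans sm'); apply: ler_wpM2r.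
  apply: addr_ge0; apply: divr_ge0 => //; apply: mulr_ge0 => //.
  - by apply: mulr_ge0 => //; apply: mulr_ge0 => //; exact: ltW.
  - by apply: mulr_ge0 => //; apply: addr_ge0.
  - by apply: mulr_ge0 => //; exact: ltW.
by rewrite -natrM ler_nat.
Qed.

End Descent.

Unset Implicit Arguments.

Theorem mainTheorem7 :
  forall R : realType,
  (* absolute constants of the O(.) and O~(.) terms, and the power of the
     hidden logarithmic factor *)
  exists (C1 C2 : R) (p : nat),
  forall (n : nat) (A : 'M[R]_n) (b : 'rV[R]_n) (c : R)
    (D : set 'rV[R]_n) (tau L1 dbar kappa delta sigma : R)
    (xstar x1 : 'rV[R]_n) (K K0 : nat)
    (d : measure_display) (Omega : measurableType d)
    (P : probability Omega R)
    (u : nat -> Omega -> 'rV[R]_n) (xi : nat -> Omega -> R),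
  let f := quad A b c in
  (* domain, holomorphic-extension radius, minimizer *)
  open (D : set (_ : normedModType R)) ->
  0 < dbar < 1 ->
  D xstar -> (forall x, D x -> f xstar <= f x) ->
  (* tau(f)-strong convexity and L1(f)-Lipschitz gradient on D *)
  0 < tau ->
  (forall x y, D x -> D y ->
     f x + dotv (grad f x) (y - x) + tau / 2 * norm2 (y - x) ^+ 2 <= f y) ->
  0 < L1 ->
  (forall x y, D x -> D y ->
     norm2 (grad f x - grad f y) <= L1 * norm2 (x - y)) ->
  (* parameters *)
  0 < kappa < 1 -> 0 < delta <= kappa * dbar -> 0 < sigma ->
  K0 = Num.truncn (4 * n%:R * L1 ^+ 2 / tau ^+ 2) ->
  (2 * K0 <= K)%N ->
  D x1 ->
  (* random directions and oracle noise *)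
  (forall k, (1 <= k <= K)%N -> uniform_on_sphere P (u k)) ->
  (forall k, (1 <= k <= K)%N ->
     measurable_fun setT (xi k) /\
     P.-integrable setT (fun w => (xi k w)%:E) /\
     (\int[P]_w (xi k w)%:E = 0)%E /\
     (\int[P]_w ((xi k w) ^+ 2)%:E <= sigma%:E)%E) ->
  mutually_independent P K u xi ->
  let mu := fun k : nat =>
    if (k <= K0)%N then (tau * K%:R)^-1 else 2 / (tau * k%:R) in
  let x := fun (k : nat) (w : Omega) =>
    cs_iter (quadC A b c) x1 mu (fun _ => delta)
            (fun j => u j w) (fun j => xi j w) k in
  let xbar := fun w : Omega =>
    (K - K0)%:R^-1 *: \sum_(K0.+1 <= k < K.+1) x k w in
  (\int[P]_w ((f (xbar w) - f xstar)%:E)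
   <= (C1 * (n%:R * L1 ^+ 2 / tau) * norm2 (x1 - xstar) ^+ 2 / K%:R
       + C2 * (1 + ln K%:R) ^+ p * (n%:R ^+ 2 * sigma / (tau * delta ^+ 2))
         / K%:R)%:E)%E.
Proof.
move=> R; exists 2, 3, 1%N.
move=> n A b c D tau L1 dbar kappa delta sigma xstar x1 K K0 d Omega P u xi.
move=> f oD _ Dxs fmin tau0 sc L10 lip kap /andP[delta0 _] sigma0 K0E K0K Dx1.
move=> uu hxi ind.
pose mu k : R := if (k <= K0)%N then (tau * K%:R)^-1 else 2 / (tau * k%:R).
pose x k w := cs_iter (quadC A b c) x1 mu (fun=> delta) (u^~ w) (xi^~ w) k.
pose xbar w := (K - K0)%:R^-1 *: \sum_(K0.+1 <= k < K.+1) x k w.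
change (\int[P]_w (f (xbar w) - f xstar)%:E <=
  (2 * (n%:R * L1 ^+ 2 / tau) * norm2 (x1 - xstar) ^+ 2 / K%:R +
   3 * (1 + ln K%:R) ^+ 1 * (n%:R ^+ 2 * sigma / (tau * delta ^+ 2)) / K%:R)%:E)%E.
(* In dimension 0 the space is a single point and both sides vanish; the case is split off because a
   unit vector, hence [tau <= L1], requires [n > 0]. *)
have [n0|n_gt0] := posnP n.
  have e w : f (xbar w) - f xstar = 0.
    rewrite (_ : xbar w = xstar) ?subrr//.
    by apply/rowP => i; have := leq_trans (ltn_ord i) (eq_leq n0).
  under eq_integral do rewrite e.
  have nR : n%:R = 0 :> R by rewrite n0.
  by rewrite integral0 nR expr0n /= !(mul0r, mulr0) addr0.
have strong := quad_strong_convex oD Dxs sc.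
have lips := quad_lipschitz oD Dxs L10 lip.
have grad0 := quad_min_grad0 oD Dxs fmin.
have tauL := hess_bounds_le n_gt0 L10 strong lips.
pose m := n%:R * L1 ^+ 2 / tau ^+ 2.
have m1 : 1 <= m.
  rewrite /m ler_pdivlMr ?exprn_gt0// mul1r.
  have n1 : 1 <= n%:R :> R by rewrite ler1n.
  have : tau ^+ 2 <= L1 ^+ 2 by rewrite lerXn2r// nnegrE ltW.
  move=> h; apply: (le_trans h); rewrite ler_peMl ?sqr_ge0//.
have m4 : 4 * n%:R * L1 ^+ 2 / tau ^+ 2 = 4 * m by rewrite /m !mulrA.
have /andP[K0_le K0_gt] : K0%:R <= 4 * m < K0.+1%:R.
  rewrite K0E m4; by apply: truncn_itv; rewrite mulr_ge0// (le_trans _ m1).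
have K0_gt0 : (0 < K0)%N.
  rewrite lt0n; apply/eqP => K00; by move: K0_gt; rewrite K00; clearbody m; lra.
have early k : (k <= K0)%N -> mu k = (tau * K%:R)^-1 by rewrite /mu => ->.
have late k : (K0 < k)%N -> mu k = 2 / (tau * k%:R).
  by rewrite /mu ltnNge => /negbTE ->.
rewrite norm2_sqr expr1.
exact: (expected_gap_rate c x1 n_gt0 delta0 grad0 lips uu hxi ind tau0 strong
  (ltW sigma0) K0_le K0_gt K0_gt0 K0K early late).
Qed.
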